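(* For all sufficiently large $n$, $SPEX_P(n,K_5\setminus e)=\{2K_1+C_{n-2}\}$.
   Context: All graphs are finite and simple. $K_5\setminus e$ is the complete graph on 5 vertices with one edge removed (equivalently $K_2+P_3$). A graph is $F$-free if it has no subgraph isomorphic to $F$. The spectral radius of a graph is the largest eigenvalue of its adjacency matrix. $SPEX_P(n,F)$ denotes the set of $n$-vertex $F$-free planar graphs whose spectral radius is maximum among all $n$-vertex $F$-free planar graphs (up to isomorphism). $C_m$ is the cycle on $m$ vertices; the join $G_1+G_2$ of vertex-disjoint graphs is obtained from $G_1\cup G_2$ by adding all edges between $V(G_1)$ and $V(G_2)$; $2K_1$ is two nonadjacent vertices. *)

(* Defs.v *)
From HB Require Import structures.
From mathcomp Require Import all_boot all_order all_algebra.
From mathcomp Require Import all_classical all_reals all_analysis.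

Set Implicit Arguments.
Unset Strict Implicit.
Unset Printing Implicit Defensive.

Import Order.TTheory GRing.Theory Num.Theory.
Import numFieldNormedType.Exports.

Local Open Scope classical_set_scope.
Local Open Scope ring_scope.

Record sgraph := SGraph {
  vertex :> finType;
  edge : rel vertex;
  edge_sym : symmetric edge;
  edge_irr : irreflexive edge }.

Arguments edge {s} x y.

Definition isomorphic (G H : sgraph) : Prop :=
  exists2 f : G -> H, bijective f & {mono f : x y / edge x y}.

(* Subgraphs need not be induced: a copy of F only has to preserve edges. *)
Definition has_copy (F G : sgraph) : Prop :=
  exists2 f : F -> G, injective f & {homo f : x y / edge x y}.

Definition free (F G : sgraph) : Prop := ~ has_copy F G.

Section Spectral.
Variable R : realType.

Definition adjmx (G : sgraph) : 'M[R]_#|G| :=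
  \matrix_(i, j) (edge (enum_val i : G) (enum_val j))%:R.

(* A finite set, nonempty as soon as G has a vertex (the adjacency matrix is
   symmetric); the supremum is then the largest eigenvalue. *)
Definition spectral_radius (G : sgraph) : R :=
  sup [set a : R | eigenvalue (adjmx G) a].

End Spectral.

Section Planarity.
Variable R : realType.

Definition is_arc (a b : R * R) (A : set (R * R)) : Prop :=
  exists g : R -> R * R,
    [/\ {within `[0, 1]%classic, continuous g},
        {in `[0, 1]%classic &, injective g},
        g 0 = a, g 1 = b & A = g @` `[0, 1]%classic].

(* A drawing in the plane without crossings: p places the vertices and
   A x y is the closed curve segment, endpoints included, drawn for the edge
   xy (the values of A on non-edges are irrelevant).  The last two clauses say
   that the interior of an edge meets no vertex and no other edge. *)
Definition planar (G : sgraph) : Prop :=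
  exists (p : G -> R * R) (A : G -> G -> set (R * R)),
    [/\ injective p,
        forall x y, edge x y -> is_arc (p x) (p y) (A x y),
        forall x y, edge x y -> A x y = A y x,
        forall x y z, edge x y -> A x y (p z) -> z = x \/ z = y
      & forall x y u v, edge x y -> edge u v ->
          (x, y) <> (u, v) -> (x, y) <> (v, u) ->
          A x y `&` A u v `<=` range p].

Definition planar_free (n : nat) (F G : sgraph) : Prop :=
  [/\ #|G| = n, planar G & free F G].

(* Invariant under isomorphism: the set of isomorphism classes of extremal graphs
   is represented by the predicate of belonging to one of them. *)
Definition SPEX_P (n : nat) (F G : sgraph) : Prop :=
  planar_free n F G /\
  forall H, planar_free n F H -> spectral_radius R H <= spectral_radius R G.

End Planarity.

Section Join.
Variables G H : sgraph.

Definition join_edge : rel (G + H)%type := fun x y =>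
  match x, y with
  | inl a, inl b => edge a b
  | inr a, inr b => edge a b
  | _, _ => true
  end.

Lemma join_edge_sym : symmetric join_edge.
Proof. by move=> [x|x] [y|y] //=; exact: edge_sym. Qed.

Lemma join_edge_irr : irreflexive join_edge.
Proof. by move=> [x|x] /=; exact: edge_irr. Qed.

Definition join : sgraph := SGraph join_edge_sym join_edge_irr.

End Join.

Section Edgeless.
Variable m : nat.

Definition edgeless_edge : rel 'I_m := fun _ _ => false.

Lemma edgeless_edge_sym : symmetric edgeless_edge.
Proof. by []. Qed.

Lemma edgeless_edge_irr : irreflexive edgeless_edge.
Proof. by []. Qed.

Definition edgeless : sgraph := SGraph edgeless_edge_sym edgeless_edge_irr.

End Edgeless.

Section Cycle.
Variable m : nat.

(* The cycle C_m for m >= 3; ordS is the successor modulo m. *)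
Definition cycle_edge : rel 'I_m := fun i j =>
  (i != j) && ((ordS i == j) || (ordS j == i)).

Lemma cycle_edge_sym : symmetric cycle_edge.
Proof. by move=> i j; rewrite /cycle_edge eq_sym orbC. Qed.

Lemma cycle_edge_irr : irreflexive cycle_edge.
Proof. by move=> i; rewrite /cycle_edge eqxx. Qed.

Definition cycle_graph : sgraph := SGraph cycle_edge_sym cycle_edge_irr.

End Cycle.

(* K_5 with the edge {0, 1} removed: they are the only two vertices smaller than 2. *)
Definition K5_minus_e_edge : rel 'I_5 := fun i j =>
  (i != j) && ~~ ((i < 2)%N && (j < 2)%N).

Lemma K5_minus_e_edge_sym : symmetric K5_minus_e_edge.
Proof. by move=> i j; rewrite /K5_minus_e_edge eq_sym [(i < 2)%N && _]andbC. Qed.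

Lemma K5_minus_e_edge_irr : irreflexive K5_minus_e_edge.
Proof. by move=> i; rewrite /K5_minus_e_edge eqxx. Qed.

Definition K5_minus_e : sgraph :=
  SGraph K5_minus_e_edge_sym K5_minus_e_edge_irr.

(* Main.v *)
(* Let rho = 1 + sqrt(2n - 3), the spectral radius of 2K_1 + C_{n-2}, and let x be the
   absolute value of an eigenvector for an eigenvalue at least rho, so that
   rho x <= A x; normalize max x = 1.

   A planar drawing yields, for any two independent edges, a parity identity between
   the crossings of each edge with the horizontal half-lines issuing from the ends of
   the other; summed over all independent pairs of a K_5 or K_{3,3} these identities
   contradict each other.  The arcs need not be simple, so this also excludes K_5
   minors, and Mader's argument bounds the number of edges linearly.

   Expanding rho^2 x over walks of length two shows that two vertices u and v carry
   weight almost 1 and have almost all vertices as common neighbours.  By K_{3,3} every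
   other vertex has at most two neighbours among these; comparing weighted sums with
   rho^2 - 2 rho = 2(n - 2) shows that every other vertex is adjacent to u and v, that
   u and v are not adjacent (else K_5 - e-freeness leaves only a matching on the rest)
   and that the rest is 2-regular.  The rest is a single cycle, because a cycle together
   with a further vertex would give a K_5 minor. *)
Require Import Defs.
From HB Require Import structures.
From mathcomp Require Import all_boot all_order all_algebra.
From mathcomp Require Import all_classical all_reals all_analysis.
From mathcomp Require Import ring lra zify.
From Stdlib Require Import Btauto.

Set Implicit Arguments.
Unset Strict Implicit.
Unset Printing Implicit Defensive.

Import Order.TTheory GRing.Theory Num.Theory.
Import numFieldNormedType.Exports.

Local Open Scope ring_scope.

(** * Parity of crossings *)

Section CrossingParity.
Variable R : realType.
Implicit Types (a b c d p q : R * R) (l : seq (R * R)).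

(** The plane enters only through signs of coordinate differences. Compactness keeps the arcs of
    disjoint edges a positive distance apart, so each arc can be replaced by a finite chain of short
    steps, and a discrete parity count takes the place of Jordan's theorem. Only chains of disjoint
    edges are ever compared; hence an edge of the obstruction may be realised by a whole walk, which
    is what passes from subgraphs to minors. The edge bound may be crude: since [rho ^+ 2] is about
    2n, any linear bound makes the error terms small against n once [rho] is large. It must however
    also hold for contractions of G along stars, because these control the vertices with several
    neighbours of large weight. The weight vector is only known to satisfy 0 <= x <= 1 and [rho] x
    <= A x, so weights may vanish, and the last equality discussion has to rule this out. One
    comparison serves both directions: every competitor of spectral radius at least [rho] is the
    expected graph. *)

Definition upper (z : R * R) : bool := (0 < z.2) || ((z.2 == 0) && (0 < z.1)).

Definition vec a b : R * R := (b.1 - a.1, b.2 - a.2).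

Definition nearby (eta : R) a b : bool :=
  (`|a.1 - b.1| < eta) && (`|a.2 - b.2| < eta).

Definition apart (eta : R) a b : bool :=
  (eta <= `|a.1 - b.1|) || (eta <= `|a.2 - b.2|).

(* For a short step from [a] to [b] far from [c]: whether it crosses the
   horizontal half-line issuing from [c] to the right. *)
Definition crossing c a b : bool :=
  xorb (upper (vec c a)) (upper (vec c b)) && (c.1 < a.1).

Lemma far_sym eta a b : apart eta a b = apart eta b a.
Proof. by rewrite /apart distrC [`|a.2 - _|]distrC. Qed.

(** The positive horizontal ray belongs to [upper] and the negative one does not, so of two opposite
    nonzero vectors exactly one is upper. *)
Lemma upper_vecC eta a b : 0 < eta -> apart eta a b ->
  upper (vec a b) = negb (upper (vec b a)).
Proof.
move=> eta0; rewrite /apart /upper /vec /=.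
rewrite !subr_gt0 !subr_eq0; case: (ltgtP a.2 b.2) => //= ->.
rewrite subrr normr0; case: (ltgtP a.1 b.1) => //= ->.
by rewrite subrr normr0 leNgt eta0.
Qed.

Lemma upper_ge0 z : upper z -> 0 <= z.2.
Proof. by case/orP => [/ltW|/andP[/eqP->]]. Qed.

Lemma upperN_le0 z : negb (upper z) -> z.2 <= 0.
Proof. by rewrite negb_or -leNgt => /andP[]. Qed.

Lemma norm_lt_of_mixed (e x y z : R) : 0 <= y -> z <= 0 ->
  y - x < e -> x - z < e -> `|x| < e.
Proof. by move=> *; rewrite ltr_norml; apply/andP; split; lra. Qed.

Lemma pos_stable (e x y : R) : e <= `|x| -> e <= `|y| -> `|x - y| < e ->
  (0 < x) = (0 < y).
Proof.
rewrite !ler_normr ltr_norml => /orP[] h1 /orP[] h2 /andP[h3 h4];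
  by apply/idP/idP => h; lra.
Qed.

(* Stokes on a small cell.  If the four differences do not all lie in the same
   half-plane then they have small ordinates, hence large abscissas, all of the
   same sign. *)
Lemma crossing_cell eta a b c d : 0 < eta ->
  nearby eta a b -> nearby eta c d ->
  apart (2 * eta) a c -> apart (2 * eta) a d ->
  apart (2 * eta) b c -> apart (2 * eta) b d ->
  xorb (xorb (crossing c a b) (crossing d a b))
       (xorb (crossing a c d) (crossing b c d)) =
  xorb (xorb (upper (vec a c)) (upper (vec a d)))
       (xorb (upper (vec b c)) (upper (vec b d))).
Proof.
move=> eta0 /andP[ab1 ab2] /andP[cd1 cd2] ac ad bc bd.
have e0 : 0 < 2 * eta by rewrite mulr_gt0.
rewrite /crossing.
rewrite (upper_vecC e0 ac) (upper_vecC e0 ad) (upper_vecC e0 bc) (upper_vecC e0 bd).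
have [/and3P[/eqP<- /eqP<- /eqP<-]|ne] := boolP [&& upper (vec c a) == upper (vec c b),
   upper (vec c a) == upper (vec d a) & upper (vec c a) == upper (vec d b)].
  by case: (upper _).
pose P := [:: (a, c); (a, d); (b, c); (b, d)].
have [[u Pu u0] [v Pv v0]] : (exists2 z, z \in P & 0 <= (vec z.2 z.1).2) /\
    (exists2 z, z \in P & (vec z.2 z.1).2 <= 0).
  have ex (Q : R * R -> bool) (S : R -> bool) :
      (forall z, Q z -> S z.2) -> has (fun z => Q (vec z.2 z.1)) P ->
      exists2 z, z \in P & S (vec z.2 z.1).2.
    by move=> QS /hasP[z Pz Qz]; exists z => //; apply: QS.
  split; [apply: (ex upper (fun t => 0 <= t)) upper_ge0 _|
          apply: (ex (fun z => negb (upper z)) (fun t => t <= 0)) upperN_le0 _].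
    by move: ne => /=; do 4!case: (upper _).
  by move: ne => /=; do 4!case: (upper _).
have ab12 z t : z \in P -> t \in P ->
    `|(vec z.2 z.1).1 - (vec t.2 t.1).1| < 2 * eta /\
    `|(vec z.2 z.1).2 - (vec t.2 t.1).2| < 2 * eta.
  have shift (x x' y y' : R) : `|x - x'| < eta -> `|y - y'| < eta ->
      `|(x - y) - (x' - y')| < 2 * eta.
    move=> h h'; rewrite (_ : _ - _ = (x - x') - (y - y')); last by ring.
    by rewrite mulr2n mulrDl mul1r (le_lt_trans (ler_normB _ _)) ?ltrD.
  have z0 (x : R) : `|x - x| < eta by rewrite subrr normr0.
  by rewrite !inE => /or4P[] /eqP-> /or4P[] /eqP-> /=; split; apply: shift;
    rewrite // distrC.
have y z : z \in P -> `|(vec z.2 z.1).2| < 2 * eta.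
  move=> Pz; apply: norm_lt_of_mixed u0 v0 _ _.
    by have [_] := ab12 _ _ Pu Pz; rewrite ltr_norml => /andP[].
  by have [_] := ab12 _ _ Pz Pv; rewrite ltr_norml => /andP[].
have x z : z \in P -> 2 * eta <= `|(vec z.2 z.1).1|.
  move=> Pz; have : apart (2 * eta) z.1 z.2.
    by move: Pz; rewrite !inE => /or4P[] /eqP->.
  by rewrite /apart orbC leNgt (y z Pz).
have s z : z \in P -> (z.2.1 < z.1.1) = (c.1 < a.1).
  move=> Pz; rewrite -subr_gt0 -[RHS]subr_gt0.
  have ac' : (a, c) \in P by rewrite mem_head.
  exact: pos_stable (x _ Pz) (x _ ac') (ab12 _ _ Pz ac').1.
have sN z : z \in P -> (z.1.1 < z.2.1) = negb (c.1 < a.1).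
  move=> Pz; rewrite -(s z Pz) -leNgt lt_neqAle.
  suff -> : z.1.1 != z.2.1 by [].
  apply/eqP => E; have := x z Pz; rewrite /= E subrr normr0.
  by rewrite leNgt e0.
rewrite (s (a, d)) ?inE ?eqxx ?orbT // (sN (a, c)) ?inE ?eqxx ?orbT //.
rewrite (sN (b, c)) ?inE ?eqxx ?orbT //=.
by case: (c.1 < a.1); do 4!case: (upper _).
Qed.

(** Adds two parity identities; that the terms add up as claimed is left to [btauto]. *)
Lemma xorb_eq_trans (x x' y y' z z' : bool) : x = x' -> y = y' ->
  z = xorb x y -> z' = xorb x' y' -> z = z'.
Proof. by move=> -> -> -> ->. Qed.

Fixpoint crossings c p l : bool :=
  if l is q :: l' then xorb (crossing c p q) (crossings c q l') else false.

Lemma crossings_step eta a b p l : 0 < eta -> nearby eta a b ->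
  path (nearby eta) p l ->
  {in p :: l, forall c, apart (2 * eta) a c /\ apart (2 * eta) b c} ->
  xorb (xorb (crossings a p l) (crossings b p l))
       (xorb (crossing p a b) (crossing (last p l) a b)) =
  xorb (xorb (upper (vec a p)) (upper (vec a (last p l))))
       (xorb (upper (vec b p)) (upper (vec b (last p l)))).
Proof.
move=> eta0 ab; elim: l p => [|q l IH] p /=.
  by move=> _ _; rewrite !Bool.xorb_nilpotent.
case/andP => pq ql fl.
have [ap bp] := fl p (mem_head _ _).
have [aq bq] : apart (2 * eta) a q /\ apart (2 * eta) b q.
  by apply: fl; rewrite !inE eqxx orbT.
have E1 := IH q ql (fun c hc => fl c (mem_behead (hc : c \in behead (p :: q :: l)))).
have E2 := crossing_cell eta0 ab pq ap aq bp bq.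
apply: xorb_eq_trans E2 E1 _ _; btauto.
Qed.

(** The difference of the two chains, on the grid of pairs of positions, avoids 0, so along the
    boundary of the grid it crosses the positive horizontal axis an even number of times. Two sides
    count crossings of right half-lines; the other two count left half-lines, and the right-hand
    side converts left into right. [crossing_cell] is one cell, [crossings_step] a row. *)
Lemma crossings_paths eta p l q m : 0 < eta ->
  path (nearby eta) p l -> path (nearby eta) q m ->
  {in p :: l & q :: m, forall a c, apart (2 * eta) a c} ->
  xorb (xorb (crossings p q m) (crossings (last p l) q m))
       (xorb (crossings q p l) (crossings (last q m) p l)) =
  xorb (xorb (upper (vec p q)) (upper (vec p (last q m))))
       (xorb (upper (vec (last p l) q)) (upper (vec (last p l) (last q m)))).
Proof.
move=> eta0; elim: l p => [|p' l IH] p /=.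
  by move=> _ _ _; rewrite !Bool.xorb_nilpotent.
case/andP => pp pl qm fl.
have E1 := IH p' pl qm (fun a c ha => fl a c (mem_behead (ha : a \in behead (p :: p' :: l)))).
have p'in : p' \in [:: p, p' & l] by rewrite !inE eqxx orbT.
have E2 := crossings_step eta0 pp qm
   (fun c hc => conj (fl p c (mem_head _ _) hc) (fl p' c p'in hc)).
apply: xorb_eq_trans E2 E1 _ _; btauto.
Qed.

(** * Parity identities for pairs of disjoint edges *)

Section Drawing.
Variables (eta : R) (E : rel nat) (r : nat -> R * R) (l : nat -> nat -> seq (R * R)).
Hypothesis eta0 : 0 < eta.
Hypothesis l_path : forall i j, E i j -> path (nearby eta) (r i) (l i j).
Hypothesis l_last : forall i j, E i j -> last (r i) (l i j) = r j.
Hypothesis l_far : forall i j k m, E i j -> E k m -> uniq [:: i; j; k; m] ->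
  {in r i :: l i j & r k :: l k m, forall a c, apart (2 * eta) a c}.

Let K k i j := crossings (r k) (r i) (l i j).
Let U i k := upper (vec (r i) (r k)).

Lemma disjoint_edges_parity i j k m : E i j -> E k m -> uniq [:: i; j; k; m] ->
  xorb (xorb (K i k m) (K j k m)) (xorb (K k i j) (K m i j)) =
  xorb (xorb (U i k) (U i m)) (xorb (U j k) (U j m)).
Proof.
move=> ij km un; have := crossings_paths eta0 (l_path ij) (l_path km) (l_far ij km un).
by rewrite (l_last ij) (l_last km).
Qed.

Lemma upper_antisym i j k m : E i j -> E k m -> uniq [:: i; j; k; m] ->
  [/\ U k i = negb (U i k), U m i = negb (U i m),
      U k j = negb (U j k) & U m j = negb (U j m)].
Proof.
move=> ij km un; have e0 : 0 < 2 * eta by rewrite mulr_gt0.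
have F x y : x \in r i :: l i j -> y \in r k :: l k m ->
    upper (vec y x) = negb (upper (vec x y)).
  move=> hx hy; apply: upper_vecC e0 _; rewrite far_sym.
  exact: l_far ij km un _ _ hx hy.
have hi := mem_head (r i) (l i j); have hk := mem_head (r k) (l k m).
have hj : r j \in r i :: l i j by rewrite -(l_last ij) mem_last.
have hm : r m \in r k :: l k m by rewrite -(l_last km) mem_last.
by split; apply: F.
Qed.

Definition independent_pair (t : nat * nat * nat * nat) : bool :=
  let: (i, j, k, m) := t in [&& E i j, E k m & uniq [:: i; j; k; m]].

(* The parity identity of a pair of edges is linear in the atoms [K k i j] and
   [U i k] with [i < k]; each reversal [U k i = ~~ U i k] contributes a one. *)
Definition reversals (t : nat * nat * nat * nat) : nat :=
  let: (i, j, k, m) := t in ((k < i) + (m < i) + (k < j) + (m < j))%N.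

Definition atoms (t : nat * nat * nat * nat) : seq (nat * nat * nat + nat * nat) :=
  let: (i, j, k, m) := t in
  [:: inl (i, k, m); inl (j, k, m); inl (k, i, j); inl (m, i, j);
      inr (minn i k, maxn i k); inr (minn i m, maxn i m);
      inr (minn j k, maxn j k); inr (minn j m, maxn j m)].

Definition atom_value (x : nat * nat * nat + nat * nat) : bool :=
  match x with inl (k, i, j) => K k i j | inr (i, k) => U i k end.

Lemma pair_parity t : independent_pair t ->
  \big[addb/false]_(x <- atoms t) atom_value x = odd (reversals t).
Proof.
case: t => [[[i j] k] m] /and3P[ij km un]; have := disjoint_edges_parity ij km un.
have [A1 A2 A3 A4] := upper_antisym ij km un.
have V x y : U y x = negb (U x y) ->
    U x y = xorb (y < x)%N (atom_value (inr (minn x y, maxn x y))).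
  rewrite /= /minn /maxn => h; rewrite [in LHS](_ : U x y = negb (U y x)) ?h ?negbK //.
  by rewrite ltnNge leq_eqVlt; case: (ltngtP x y) => [_|_|->] /=; rewrite ?h ?negbK //; case: (U _ _).
rewrite (V _ _ A1) (V _ _ A2) (V _ _ A3) (V _ _ A4) !big_cons big_nil.
rewrite /reversals !oddD !oddb /=.
move: (U _ _) (U (minn i m) _) (U (minn j k) _) (U (minn j m) _) => u1 u2 u3 u4.
have addE x y : xorb x y = x (+) y by case: x; case: y.
rewrite !addE addbF !addbA -(addbA (_ (+) _) (K k i j)) => ->.
move: (k < i)%N (m < i)%N (k < j)%N (m < j)%N => b1 b2 b3 b4.
by case: b1 u1 b2 u2 b3 u3 b4 u4; do 7!case.
Qed.

(* Van Kampen's obstruction: if every atom occurs an even number of times, the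
   left-hand sides of the parity identities cancel. *)
Lemma odd_reversals_undrawable s : all independent_pair s ->
  (forall x, ~~ odd (count_mem x (flatten (map atoms s)))) ->
  ~~ odd (sumn (map reversals s)).
Proof.
move=> ind ev.
have -> : odd (sumn (map reversals s)) =
    \big[addb/false]_(x <- flatten (map atoms s)) atom_value x.
  elim: s ind {ev} => [|t s IH] /=; first by rewrite big_nil.
  by case/andP => ht /IH {}IH; rewrite oddD big_cat IH pair_parity.
(* Equal atoms are grouped; an even number of copies of a boolean adds up to [false]. *)
rewrite -big_undup_iterop_count big1 // => x _.
have := ev x; move: (count_mem _ _) (atom_value x) => n b.
rewrite Monoid.iteropE; elim/ltn_ind: n => -[|[|n]] IH //=.
by rewrite negbK => /(IH n (leqW (leqnn _))) ->; case: b {IH}.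
Qed.

End Drawing.

Definition K5_edge : rel nat := [rel i j | i < j < 5]%N.
Definition K33_edge : rel nat := [rel i j | (i < 3 <= j) && (j < 6)]%N.

(** Comparing the first ends keeps each unordered pair of disjoint edges once. *)
Definition independent_pairs (E : rel nat) n : seq (nat * nat * nat * nat) :=
  let es := [seq (i, j) | i <- iota 0 n, j <- iota 0 n] in
  [seq t <- [seq (e.1, e.2, f.1, f.2) | e <- es, f <- es] |
     independent_pair E t && (t.1.1.1 < t.1.2)%N].

Lemma undrawable (E : rel nat) n eta (r : nat -> R * R) (l : nat -> nat -> seq (R * R)) :
  let s := independent_pairs E n in
  let a := flatten (map atoms s) in
  odd (sumn (map reversals s)) -> all (fun x => ~~ odd (count_mem x a)) a ->
  0 < eta ->
  (forall i j, E i j -> path (nearby eta) (r i) (l i j)) ->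
  (forall i j, E i j -> last (r i) (l i j) = r j) ->
  (forall i j k m, E i j -> E k m -> uniq [:: i; j; k; m] ->
    {in r i :: l i j & r k :: l k m, forall a c, apart (2 * eta) a c}) ->
  False.
Proof.
move=> s a od ev eta0 lp ll lf; move: od; apply/negP.
apply: (odd_reversals_undrawable eta0 lp ll lf) => [|x].
  by apply/allP => t; rewrite mem_filter => /andP[/andP[]].
have [xa|xa] := boolP (x \in a); first exact: (allP ev).
by rewrite (count_memPn xa).
Qed.

(** Of the 15 pairs, two involve a given edge and a given vertex off it, and six separate two given
    vertices; hence all multiplicities are even. *)
Lemma K5_undrawable_check :
  let s := independent_pairs K5_edge 5 in
  let a := flatten (map atoms s) in
  odd (sumn (map reversals s)) && all (fun x => ~~ odd (count_mem x a)) a.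
Proof. by vm_compute. Qed.

(** Here there are 18 pairs; an edge and a vertex off it occur twice, two vertices six times on the
    same side and four times on opposite sides. *)
Lemma K33_undrawable_check :
  let s := independent_pairs K33_edge 6 in
  let a := flatten (map atoms s) in
  odd (sumn (map reversals s)) && all (fun x => ~~ odd (count_mem x a)) a.
Proof. by vm_compute. Qed.

End CrossingParity.

(** * Planar graphs have no K_5 minor and no K_{3,3} *)

Section Drawings.
Variable R : realType.
Local Open Scope classical_set_scope.

Lemma nearbyE (eta : R) (a b : R * R) : ball a eta b <-> nearby eta a b.
Proof. by split=> [[? ?]|/andP[]]; [apply/andP|]. Qed.

Lemma apartN (eta : R) (a b : R * R) : ~ ball a eta b -> apart eta a b.
Proof.
by move=> /nearbyE/negP; rewrite negb_and -!leNgt.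
Qed.

(** Stated for all small [eta], so that finitely many pairs of edges can share one value. *)
Lemma compact_apart (A B : set (R * R)) :
  compact A -> closed B -> A `&` B = set0 ->
  \forall eta \near 0^'+, forall a b, A a -> B b -> apart (2 * eta) a b.
Proof.
move=> /compact_near_coveringP cA cB AB.
have : \forall eta \near 0^'+, A `<=` (fun a => forall b, B b -> apart (2 * eta) a b).
  apply: cA => x Ax.
  have /nbhs_ballP[e /= e0 xe] : nbhs x (~` B).
    apply: open_nbhs_nbhs; split; first exact: closed_openC.
    by move=> Bx; have : (A `&` B) x by []; rewrite AB.
  exists (ball x (e / 2), [set eta | eta < e / 4]) => /=.
    split; first by apply: nbhsx_ballx; rewrite divr_gt0.
    by apply: nbhs_right_lt; rewrite divr_gt0.
  move=> [y eta] /= [xy etae] b Bb; apply: apartN => yb.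
  apply: (xe b) Bb; have := ball_triangle xy yb.
  by apply: le_ball; lra.
by apply: filterS => eta h a b Aa Bb; exact: h.
Qed.

Lemma arc_compact (a b : R * R) A : is_arc a b A -> compact A.
Proof.
case=> g [gc _ _ _ ->]; apply: continuous_compact gc _; exact: segment_compact.
Qed.

(** The points of the arc reachable by chains form a nonempty subset that is open and closed in a
    connected set. *)
Lemma arc_chain (eta : R) (a b : R * R) A : 0 < eta -> is_arc a b A ->
  exists l, [/\ path (nearby eta) a l, last a l = b & forall q, q \in a :: l -> A q].
Proof.
move=> eta0 arcA; have cA : connected A.
  case: arcA => g [gc _ _ _ ->]; apply: connected_continuous_connected gc.
  exact: segment_connected.
have [Aa Ab] : A a /\ A b.
  case: arcA => g [_ _ <- <- ->]; split.
    by exists 0 => //; rewrite /= in_itv /= lexx ler01.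
  by exists 1 => //; rewrite /= in_itv /= lexx ler01.
pose C := [set c | A c /\ exists l,
  [/\ path (nearby eta) a l, last a l = c & forall q, q \in a :: l -> A q]].
have step c d : C c -> A d -> ball c eta d -> C d.
  move=> [_ [l [pl lc lA]]] Ad cd; split => //; exists (rcons l d).
  rewrite rcons_path last_rcons pl lc; split => //; first exact/nearbyE.
  by move=> q; rewrite -rcons_cons mem_rcons inE => /orP[/eqP->//|]; exact: lA.
have CA : C = A.
  apply: cA.
  - by exists a; split => //; exists [::]; split => // q; rewrite inE => /eqP->.
  - exists (\bigcup_(c in C) ball c eta).
      by apply: bigcup_open => c _; exact: ball_open.
    apply/seteqP; split => [c Cc|d [Ad [c Cc cd]]]; last exact: step cd.
    by split; [case: Cc | exists c => //; exact: ballxx].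
  - exists (~` \bigcup_(c in A `\` C) ball c eta).
      by apply: open_closedC; apply: bigcup_open => c _; exact: ball_open.
    apply/seteqP; split => [c Cc|d [Ad dN]].
      split; first by case: Cc.
      by move=> [d [Ad]]; apply: contra_not => /ball_sym dc; exact: step dc.
    apply: contrapT => nCd; apply: dN; exists d => //; exact: ballxx.
have [_] : C b by rewrite CA.
by [].
Qed.

Definition disjoint_edges (G : sgraph) (x y u v : G) :=
  [&& x != u, x != v, y != u & y != v].

(** A common point of the arcs of two disjoint edges would be a vertex, hence an end of both. So the
    arcs are disjoint compact sets, and one [eta] works for the finitely many pairs. *)
Lemma planar_chains (G : sgraph) : planar R G ->
  exists (p : G -> R * R) (l : G -> G -> seq (R * R)) (eta : R),
  [/\ 0 < eta,
      forall x y, edge x y -> path (nearby eta) (p x) (l x y),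
      forall x y, edge x y -> last (p x) (l x y) = p y
    & forall x y u v, edge x y -> edge u v -> disjoint_edges x y u v ->
      {in p x :: l x y & p u :: l u v, forall a b, apart (2 * eta) a b}].
Proof.
move=> [p [A [pinj arcA _ vA AA]]].
pose Q (t : G * G * (G * G)) (eta : R) := let: (x, y, (u, v)) := t in
  edge x y -> edge u v -> disjoint_edges x y u v ->
  forall a b, A x y a -> A u v b -> apart (2 * eta) a b.
have : \forall eta \near (0 : R)^'+, forall t, Q t eta.
  apply: filter_forall => -[[x y] [u v]]; rewrite /Q.
  have [xy|nxy] := boolP (edge x y); last by apply: nearW => eta /negP.
  have [uv|nuv] := boolP (edge u v); last by apply: nearW => eta _ /negP.
  have [/and4P[xu xv yu yv]|nd] := boolP (disjoint_edges x y u v);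
    last by apply: nearW => eta _ _ /negP.
  have disj : A x y `&` A u v = set0.
    apply/seteqP; split => // q [q1 q2].
    have [z _ zq] : range p q.
      by apply: AA (conj q1 q2) => // -[/eqP]; rewrite ?(negPf xu) ?(negPf xv).
    rewrite -zq in q1 q2.
    have zx := vA _ _ _ xy q1; have zu := vA _ _ _ uv q2; move: xu xv yu yv.
    by case: zx => <-; case: zu => <-; rewrite eqxx.
  have far := compact_apart (arc_compact (arcA _ _ xy))
    (compact_closed (@norm_hausdorff _ _) (arc_compact (arcA _ _ uv))) disj.
  by apply: filterS far => eta far _ _ _; exact: far.
move=> /(filterI (nbhs_right_gt (0 : R)))/filter_ex[eta [/= eta0 far]].
have chain (t : G * G) : exists l, edge t.1 t.2 ->
    [/\ path (nearby eta) (p t.1) l, last (p t.1) l = p t.2 &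
        forall q, q \in p t.1 :: l -> A t.1 t.2 q].
  have [xy|/negP nxy] := boolP (edge t.1 t.2); last by exists [::].
  by have [l ?] := arc_chain eta0 (arcA _ _ xy); exists l.
have [l lP] := boolp.choice chain.
exists p, (fun x y => l (x, y)), eta; split => //.
- by move=> x y xy; have [] := lP (x, y) xy.
- by move=> x y xy; have [] := lP (x, y) xy.
- move=> x y u v xy uv d a b al bl.
  have [_ _ Axy] := lP (x, y) xy; have [_ _ Auv] := lP (u, v) uv.
  by apply: (far ((x, y), (u, v)) xy uv d); [exact: Axy|exact: Auv].
Qed.

End Drawings.

(** * Clique minors in dense graphs *)

Section Minors.
Variable T : finType.
Implicit Types (e : rel T) (S W : {set T}) (f : T -> T).

Definition within e S : rel T := [rel x y | [&& e x y, x \in S & y \in S]].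

Definition connected_in e S := {in S &, forall x y, connect (within e S) x y}.

Definition clique_minor r e S (phi : 'I_r -> {set T}) : Prop :=
  [/\ forall i, phi i \subset S,
      forall i, phi i != finset.set0,
      forall i, connected_in e (phi i),
      forall i j, i != j -> [disjoint phi i & phi j]
    & forall i j, i != j ->
        exists x y, [/\ x \in phi i, y \in phi j & e x y]].

Definition deg_in e S x := #|[set y in S | e x y]|.

(* The ordered count, i.e. twice the number of edges inside [S]. *)
Definition darts_in e S := (\sum_(x in S) deg_in e S x)%N.

(** The contracted graph keeps the vertex type: [f] sends a vertex to its representative, and a
    vertex outside the image of [f] becomes isolated. Inductions then shrink [S] only. *)
Definition contract e f : rel T := [rel x y | (x != y) &&
  [exists x', [exists y', [&& f x' == x, f y' == y & e x' y']]]].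

Lemma contractP e f x y :
  reflect (x != y /\ exists x' y', [/\ f x' = x, f y' = y & e x' y']) (contract e f x y).
Proof.
apply: (iffP andP) => [[-> /existsP[x' /existsP[y' /and3P[/eqP ? /eqP ? ?]]]]|].
  by split => //; exists x', y'.
case=> -> [x' [y' [fx fy xy]]]; split=> //.
by apply/existsP; exists x'; apply/existsP; exists y'; rewrite fx fy !eqxx.
Qed.

Lemma contract_sym e f : symmetric e -> symmetric (contract e f).
Proof.
move=> es x y; apply/contractP/contractP => -[ne [x' [y' [? ? ?]]]];
  by split; rewrite 1?eq_sym //; exists y', x'; rewrite es.
Qed.

Lemma contract_irr e f : irreflexive (contract e f).
Proof. by move=> x; rewrite /contract /= eqxx. Qed.

Lemma within_sym e S : symmetric e -> symmetric (within e S).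
Proof. by move=> es x y; rewrite /within /= es [(x \in S) && _]andbC. Qed.

Lemma clique_minorS r e S S' (phi : 'I_r -> {set T}) :
  S \subset S' -> clique_minor e S phi -> clique_minor e S' phi.
Proof.
by move=> SS' [sub ? ? ? ?]; split => // i; apply: fintype.subset_trans SS'.
Qed.

Definition pull f W : {set T} := [set x | f x \in W].

(* [f] contracts stars onto their centres. *)
Lemma clique_minor_pull r e S f (phi : 'I_r -> {set T}) :
  symmetric e -> {in S, forall x, f x = x} ->
  (forall x, f x \in S -> f x = x \/ e x (f x)) ->
  clique_minor (contract e f) S phi ->
  clique_minor e (pull f S) (fun i => pull f (phi i)).
Proof.
move=> es fS fe [sub ne conn disj adj].
have inS i x : x \in phi i -> x \in S by exact/fintype.subsetP/sub.
split.
- by move=> i; apply/fintype.subsetP => x; rewrite !inE; exact: inS.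
- move=> i; have /finset.set0Pn[x xi] := ne i; apply/finset.set0Pn; exists x.
  by rewrite inE fS ?(inS i).
- move=> i; set W := pull f (phi i).
  have csym : connect_sym (within e W) by exact/sym_connect_sym/within_sym.
  have toC x : x \in W -> connect (within e W) x (f x).
    move=> xW; have fxi : f x \in phi i by rewrite inE in xW.
    have [->|xf] := fe x (inS _ _ fxi); first exact: connect0.
    by apply: connect1; rewrite /within /= xf xW inE fS // (inS i).
  move=> a b aW bW; apply: connect_trans (toC a aW) _.
  rewrite csym; apply: connect_trans (toC b bW) _; rewrite csym.
  rewrite inE in aW; rewrite inE in bW; have := conn i _ _ aW bW.
  apply: connect_sub => x y /and3P[/contractP[_ [x' [y' [fx fy xy]]]] xi yi].
  have x'W : x' \in W by rewrite inE fx.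
  have y'W : y' \in W by rewrite inE fy.
  rewrite -fx csym; apply: connect_trans (toC _ x'W).
  rewrite csym -fy; apply: connect_trans (toC _ y'W).
  by apply: connect1; rewrite /within /= xy x'W.
- move=> i j /disj; rewrite -!setI_eq0 => /eqP dij.
  by apply/eqP/finset.setP => x; have /finset.setP/(_ (f x)) := dij; rewrite !inE.
- move=> i j /adj[x [y [xi yj /contractP[_ [x' [y' [fx fy xy]]]]]]].
  by exists x', y'; rewrite !inE fx fy.
Qed.

Definition common e S a b := [set y in S | e a y && e b y].

Definition identify a b (x : T) : T := if x == b then a else x.

(** Contracting ab loses the edge ab itself and merges two edges into one at each common neighbour;
    every lost edge counts for two darts. *)
Lemma darts_contract_edge e S a b : symmetric e -> irreflexive e ->
  a \in S -> b \in S -> e a b ->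
  (darts_in e S <=
   darts_in (contract e (identify a b)) (S :\ b) + (#|common e S a b|.*2).+2)%N.
Proof.
move=> es ei aS bS ab; set f := identify a b.
have nab : a != b by apply/eqP => E; rewrite E ei in ab.
have ba : e b a by rewrite es.
have fa : f a = a by rewrite /f /identify (negPf nab).
have fb : f b = a by rewrite /f /identify eqxx.
have fx x : x != b -> f x = x by rewrite /f /identify => /negPf->.
have aSb : a \in S :\ b by rewrite !inE nab.
have -> : darts_in e S = (deg_in e S b + (deg_in e S a +
    \sum_(x in S | (x != b) && (x != a)) deg_in e S x))%N.
  rewrite /darts_in (bigD1 b bS) (bigD1 a) /=; last exact/andP.
  by congr (_ + (_ + _))%N; apply: eq_bigl => x; rewrite -andbA.
have -> : darts_in (contract e f) (S :\ b) = (deg_in (contract e f) (S :\ b) a +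
    \sum_(x in S :\ b | x != a) deg_in (contract e f) (S :\ b) x)%N.
  by rewrite /darts_in (bigD1 a aSb).
(* The degrees of [a] and [b] add up to union plus intersection of the neighbourhoods, and the union
   contains [a] and [b] themselves. *)
have da : (deg_in e S a + deg_in e S b <=
    deg_in (contract e f) (S :\ b) a + #|common e S a b|.+2)%N.
  rewrite /deg_in -cardsUI.
  have -> : [set y in S | e a y] :&: [set y in S | e b y] = common e S a b.
    by apply/finset.setP => y; rewrite !inE andbACA andbb.
  set U := _ :|: _.
  have aU : a \in U by rewrite !inE aS ba orbT.
  have bU : b \in U :\ a by rewrite !inE bS ab eq_sym nab.
  have cU : #|U| = #|U :\ a :\ b|.+2.
    by rewrite (cardsD1 a U) aU (cardsD1 b (U :\ a)) bU.
  suff : (#|U :\ a :\ b| <= #|[set y in S :\ b | contract e f a y]|)%N by lia.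
  apply/subset_leq_card/fintype.subsetP => y; rewrite !inE.
  case/and3P => yb ya /orP[] /andP[yS ay]; rewrite yb yS /=; apply/contractP;
    (split; first by rewrite eq_sym); [exists a, y|exists b, y]; by rewrite (fx _ yb).
have dx x : x \in S -> x != a -> x != b ->
    (deg_in e S x <= deg_in (contract e f) (S :\ b) x + (x \in common e S a b))%N.
  move=> xS xa xb; rewrite /deg_in inE xS /= -(es x a) -(es x b).
  have sub : [set y in S | e x y] :\ b \subset [set y in S :\ b | contract e f x y].
    apply/fintype.subsetP => y; rewrite !inE => /and3P[yb yS xy]; rewrite yb yS /=.
    apply/contractP; split; first by apply/eqP => E; rewrite E ei in xy.
    by exists x, y; rewrite !fx.
  have [xeb|nxb] := boolP (e x b); last first.
    rewrite andbF addn0; apply: leq_trans (subset_leq_card sub).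
    by rewrite [X in (_ <= X)%N](_ : _ = #|[set y in S | e x y]|) // [RHS](cardsD1 b) !inE (negPf nxb) andbF.
  rewrite (cardsD1 b [set y in S | e x y]) !inE bS xeb /= andbT.
  have [xea|nxa] := boolP (e x a); first by rewrite addnC leq_add2r subset_leq_card.
  have cE : #|a |: ([set y in S | e x y] :\ b)| = (1 + #|[set y in S | e x y] :\ b|)%N.
    by rewrite cardsU1 !inE (negPf nxa) !andbF.
  rewrite addn0 -cE.
  apply/subset_leq_card; rewrite finset.subUset sub andbT finset.sub1set !inE nab aS.
  by apply/contractP; split => //; exists x, b; rewrite fx.
have dsum : (\sum_(x in S | (x != b) && (x != a)) deg_in e S x <=
   \sum_(x in S :\ b | x != a) deg_in (contract e f) (S :\ b) x + #|common e S a b|)%N.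
  have cE : #|common e S a b| =
      (\sum_(x in S :\ b | x != a) (x \in common e S a b))%N.
    rewrite -sum1_card big_mkcond [RHS]big_mkcond /=; apply: eq_bigr => x _.
    rewrite !inE; case: (x =P a) => [->|]; first by rewrite ei !andbF.
    by case: (x =P b) => [->|]; rewrite ?ei ?andbF //=; case: (x \in S).
  rewrite cE -big_split /= (eq_bigl (fun x => (x \in S :\ b) && (x != a))); last first.
    by move=> x; rewrite !inE andbA [(x \in S) && _]andbC.
  by apply: leq_sum => x /andP[/finset.setD1P[xb xS] xa]; exact: dx.
by move: da dsum; lia.
Qed.

(* Mader: contract edges lying in few triangles; if every edge lies in many
   triangles, recurse in the neighbourhood of a vertex. *)
Lemma clique_minor_of_darts r e S : symmetric e -> irreflexive e ->
  S != finset.set0 -> (2 ^ r * #|S| <= darts_in e S)%N ->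
  exists phi : 'I_r.+1 -> {set T}, clique_minor e S phi.
Proof.
elim: r e S => [|r IHr] e S es ei.
  move=> /finset.set0Pn[x xS] _; exists (fun=> [set x]); split.
  - by move=> _; rewrite finset.sub1set.
  - by move=> _; apply/finset.set0Pn; exists x; rewrite inE.
  - by move=> _ a b; rewrite !inE => /eqP-> /eqP->; exact: connect0.
  - by move=> i j; rewrite !ord1 eqxx.
  - by move=> i j; rewrite !ord1 eqxx.
(* Inner induction on the size of [S], for contractions; the outer one on [r] is for
   neighbourhoods. *)
have [m] := ubnP #|S|; elim: m e S es ei => // m IHm e S es ei Sm S0 dS.
have [/existsP[a /existsP[b /and4P[aS bS ab tab]]]|nex] := boolP [exists a, [exists b,
    [&& a \in S, b \in S, e a b & (#|common e S a b| < 2 ^ r)%N]]].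
  pose f := identify a b.
  have nab : a != b by apply/eqP => E; rewrite E ei in ab.
  have Sb : #|S| = #|S :\ b|.+1 by rewrite (cardsD1 b) bS.
  have [] := IHm (contract e f) (S :\ b) (contract_sym f es) (contract_irr e f).
  - by rewrite -ltnS -Sb.
  - by apply/finset.set0Pn; exists a; rewrite !inE nab.
  (* At most 2 * (2^r - 1) + 2 = 2^(r+1) darts are lost, which is what the bound concedes for one
     vertex fewer. *)
  - have := darts_contract_edge es ei aS bS ab; rewrite -/f => h.
    move: h dS; rewrite Sb expnS; move: tab => /=; nia.
  move=> phi phiP; exists (fun i => pull f (phi i)).
  apply: (@clique_minorS _ _ (pull f (S :\ b))).
    apply/fintype.subsetP => x; rewrite !inE /f /identify.
    by case: (x =P b) => [-> //|_ /andP[]].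
  apply: clique_minor_pull phiP => //.
    by move=> x; rewrite !inE /f /identify => /andP[/negPf->].
  move=> x; rewrite /f /identify; case: (x =P b) => [-> _|]; last by left.
  by right; rewrite es.
(* Now every edge lies in at least 2^r triangles, so inside the neighbourhood of [a] all degrees are
   at least 2^r; [a] alone becomes the additional branch set. *)
have [a aS da] : exists2 a, a \in S & (0 < deg_in e S a)%N.
  apply/exists_inP; apply: contraTT dS => /exists_inPn h.
  rewrite -ltnNge /darts_in big1 => [|a aS]; last by apply/eqP; rewrite -leqn0 leqNgt h.
  by rewrite muln_gt0 expn_gt0 card_gt0.
pose N := [set y in S | e a y].
have [] := IHr e N es ei.
- by rewrite -card_gt0.
- rewrite mulnC /darts_in -sum_nat_const; apply: leq_sum => b.
  rewrite inE => /andP[bS ab]; rewrite leqNgt; apply: contra nex => h.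
  apply/existsP; exists a; apply/existsP; exists b; rewrite aS bS ab.
  rewrite (_ : common e S a b = [set y in N | e b y]) //.
  by apply/finset.setP => y; rewrite !inE andbA.
move=> phi [sub ne conn disj adj].
pose psi (i : 'I_r.+2) := if unlift ord0 i is Some j then phi j else [set a].
have inN j x : x \in phi j -> (x \in S) && e a x.
  by move=> xj; have := fintype.subsetP (sub j) x xj; rewrite inE.
have aphi j : a \notin phi j by apply/negP => /inN; rewrite ei andbF.
exists psi; split.
- move=> i; rewrite /psi; case: (unliftP ord0 i) => [j _|_]; last by rewrite finset.sub1set.
  by apply/fintype.subsetP => x /inN/andP[].
- move=> i; rewrite /psi; case: (unliftP ord0 i) => [j _ //|_].
  by apply/finset.set0Pn; exists a; rewrite inE.
- move=> i; rewrite /psi; case: (unliftP ord0 i) => [j _ //|_] x y.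
  by rewrite !inE => /eqP-> /eqP->; exact: connect0.
- move=> i j; rewrite /psi.
  case: (unliftP ord0 i) => [i' ->|->]; case: (unliftP ord0 j) => [j' ->|->] //.
  + by rewrite (inj_eq lift_inj) => /disj.
  + by move=> _; rewrite disjoint_sym disjoints1.
  + by move=> _; rewrite disjoints1.
- move=> i j; rewrite /psi.
  case: (unliftP ord0 i) => [i' ->|->]; case: (unliftP ord0 j) => [j' ->|->] //.
  + by rewrite (inj_eq lift_inj) => /adj.
  + move=> _; have /finset.set0Pn[x xi] := ne i'; exists x, a.
    by rewrite inE eqxx xi es; case/andP: (inN _ _ xi).
  + move=> _; have /finset.set0Pn[x xi] := ne j'; exists a, x.
    by rewrite inE eqxx xi; case/andP: (inN _ _ xi).
Qed.

End Minors.

(** * Forbidden minors and linear edge bounds for planar graphs *)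

Section PlanarObstructions.
Variables (R : realType) (G : sgraph).
Hypothesis planarG : planar R G.

(** Since [x != y], the walk has an edge, so every point of the concatenated chain lies on an edge
    inside [W]; this separates chains belonging to disjoint sets [W]. *)
Lemma walk_chain (p : G -> R * R) (l : G -> G -> seq (R * R)) (eta : R)
    (W : {set G}) (x y : G) :
  (forall x y, edge x y -> path (nearby eta) (p x) (l x y)) ->
  (forall x y, edge x y -> last (p x) (l x y) = p y) ->
  x != y -> connect (within edge W) x y ->
  exists L, [/\ path (nearby eta) (p x) L, last (p x) L = p y &
    forall q, q \in p x :: L -> exists a b : G,
      [/\ a \in W, b \in W, edge a b & q \in p a :: l a b]].
Proof.
move=> lp ll xy /connectP[s ps ys].
have {xy} : s != [::] by apply: contraNneq xy => s0; rewrite ys s0.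
rewrite {y}ys; elim: s x ps => // z s IH x /= /andP[/and3P[xz xW zW] ps] _.
have [->|s0] := eqVneq s [::].
  exists (l x z); split; [exact: lp|exact: ll|] => q ql.
  by exists x, z.
have [L [pL lL qL]] := IH z ps s0; exists (l x z ++ L); split.
- by rewrite cat_path lp // ll.
- by rewrite last_cat ll.
- move=> q; rewrite -cat_cons mem_cat => /orP[ql|ql]; first by exists x, z.
  by apply: qL; rewrite inE ql orbT.
Qed.

Lemma planar_undrawable (E : rel nat) n (r : nat -> G) (W : nat -> nat -> {set G}) :
  let s := independent_pairs E n in
  let a := flatten (map atoms s) in
  odd (sumn (map reversals s)) && all (fun x => ~~ odd (count_mem x a)) a ->
  (forall i j, E i j -> r i != r j) ->
  (forall i j, E i j -> connect (within edge (W i j)) (r i) (r j)) ->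
  (forall i j k m, E i j -> E k m -> uniq [:: i; j; k; m] ->
    [disjoint W i j & W k m]) ->
  False.
Proof.
move=> s a /andP[od ev] rne rconn disj.
have [p [l [eta [eta0 lp ll far]]]] := planar_chains planarG.
have chain (t : nat * nat) : exists L, E t.1 t.2 ->
    [/\ path (nearby eta) (p (r t.1)) L, last (p (r t.1)) L = p (r t.2) &
    forall q, q \in p (r t.1) :: L -> exists a b : G,
      [/\ a \in W t.1 t.2, b \in W t.1 t.2, edge a b & q \in p a :: l a b]].
  have [e|/negP ne] := boolP (E t.1 t.2); last by exists [::].
  by have [L ?] := walk_chain lp ll (rne _ _ e) (rconn _ _ e); exists L.
have [L LP] := boolp.choice chain.
apply: (@undrawable _ E n eta (p \o r) (fun i j => L (i, j)) od ev eta0).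
- by move=> i j ij; have [] := LP (i, j) ij.
- by move=> i j ij; have [] := LP (i, j) ij.
- move=> i j k m ij km un q q' qL qL'.
  have [_ _ /(_ q qL) [x [y [xW yW xy qxy]]]] := LP (i, j) ij.
  have [_ _ /(_ q' qL') [u [v [uW vW uv quv]]]] := LP (k, m) km.
  apply: (far x y u v) => //.
  have ne z t : z \in W i j -> t \in W k m -> z != t.
    by move=> zW tW; apply: contraTneq tW => <-; rewrite (disjointFr (disj _ _ _ _ ij km un) zW).
  by rewrite /disjoint_edges !ne.
Qed.

(** The edge ij of K_5 is realised by a walk through branch sets i and j. Walks of edges with a
    common end may overlap in the shared branch set, but such edges are not compared. *)
Lemma planar_no_K5_minor S (phi : 'I_5 -> {set G}) : ~ clique_minor edge S phi.
Proof.
move=> [_ ne conn disj adj].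
have rP i : {x | x \in phi (inord i)} by apply/sigW/set0Pn.
pose r i := sval (rP i).
have ri i : r i \in phi (inord i) := svalP (rP i).
have inj i j : (i < 5)%N -> (j < 5)%N -> i != j -> (inord i : 'I_5) != inord j.
  by move=> i5 j5; apply: contraNneq => /(congr1 val); rewrite /= !inordK // => ->.
apply: (@planar_undrawable K5_edge 5 r (fun i j => phi (inord i) :|: phi (inord j))
  K5_undrawable_check).
- move=> i j /andP[ij j5]; apply: contraTneq (ri j) => <-.
  rewrite (disjointFr (disj (inord i) (inord j) _) (ri i)) //.
  by rewrite inj ?(ltn_trans ij) // ltn_eqF.
- move=> i j /andP[ij j5].
  have /adj[x [y [xi yj xy]]] : (inord i : 'I_5) != inord j.
    by rewrite inj ?(ltn_trans ij) // ltn_eqF.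
  have mono (A B : {set G}) u v : A \subset B -> connect (within edge A) u v ->
      connect (within (@edge G) B) u v.
    move=> /fintype.subsetP AB; apply: connect_sub => z t /and3P[zt zA tA].
    by apply: connect1; rewrite /within /= zt !AB.
  apply: (@connect_trans _ _ x); first exact: mono (finset.subsetUl _ _) (conn _ _ _ (ri i) xi).
  apply: (@connect_trans _ _ y); last exact: mono (finset.subsetUr _ _) (conn _ _ _ yj (ri j)).
  by apply: connect1; rewrite /within /= xy !inE xi yj orbT.
- move=> i j k m /andP[ij j5] /andP[km m5]; rewrite /= !inE !negb_or !andbT.
  move=> /and3P[/and3P[_ ik im] /andP[jk jm] _].
  have i5 := ltn_trans ij j5; have k5 := ltn_trans km m5.
  rewrite -setI_eq0 finset.setIUl !finset.setIUr.
  have dI a b : (a < 5)%N -> (b < 5)%N -> a != b -> phi (inord a) :&: phi (inord b) = finset.set0.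
    by move=> a5 b5 ab; apply/eqP; rewrite setI_eq0 disj // inj.
  by rewrite !dI // !finset.setU0.
Qed.

Lemma planar_no_K33 (x1 x2 x3 : G) : uniq [:: x1; x2; x3] ->
  (#|[set y | [&& edge x1 y, edge x2 y & edge x3 y]]| <= 2)%N.
Proof.
move=> unx; rewrite leqNgt; apply/negP => /card_gt2P[y1 [y2 [y3]]].
rewrite !inE => -[[/and3P[e11 e21 e31] /and3P[e12 e22 e32] /and3P[e13 e23 e33]] [n12 n23 n31]].
pose t := [:: x1; x2; x3; y1; y2; y3].
have ne (x y : G) : edge x y -> x != y.
  by apply: contraTneq => ->; rewrite edge_irr.
have unt : uniq t.
  move: unx; rewrite /t /= !inE !negb_or => /and3P[/andP[-> ->] -> _] /=.
  by rewrite n12 n23 [y1 == y3]eq_sym n31 !ne.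
pose r i := nth x1 t i.
apply: (@planar_undrawable K33_edge 6 r (fun i j => [set r i; r j]) K33_undrawable_check).
- move=> i j /andP[/andP[i3 j3] j6]; rewrite nth_uniq //; last exact: ltn_trans i3 _.
  by rewrite ltn_eqF // (leq_trans i3).
- move=> i j ij; apply: connect1; rewrite /within /= !inE !eqxx orbT /= andbT.
  move: ij => /andP[/andP[]]; rewrite /r.
  by case: i => [|[|[|i]]] //; case: j => [|[|[|[|[|[|j]]]]]].
- move=> i j k m /andP[/andP[i3 j3] j6] /andP[/andP[k3 m3] m6]; rewrite /= !inE !negb_or !andbT.
  move=> /and3P[/and3P[_ ik im] /andP[jk jm] _].
  have i6 : (i < 6)%N by exact: leq_trans i3 _.
  have k6 : (k < 6)%N by exact: leq_trans k3 _.
  rewrite -setI_eq0; apply/eqP/finset.setP => z; rewrite !inE.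
  apply/negP => /andP[/orP[] /eqP-> /orP[]]; rewrite nth_uniq //; exact/negP.
Qed.

(** 16 = 2^4 is Mader's bound for K_5; a K_5 minor of the contraction pulls back to one of the
    planar graph. *)
Lemma planar_contract_sparse (f : G -> G) (S : {set G}) :
  {in S, forall x, f x = x} -> (forall x, f x \in S -> f x = x \/ edge x (f x)) ->
  (darts_in (contract edge f) S <= 16 * #|S|)%N.
Proof.
move=> fS fe; have [->|S0] := eqVneq S finset.set0.
  by rewrite /darts_in big_set0.
rewrite leqNgt; apply/negP => lt.
have [||//||phi] := @clique_minor_of_darts _ 4 (contract edge f) S.
- by apply: contract_sym; exact: edge_sym.
- exact: contract_irr.
- exact: ltnW.
- by move=> /(clique_minor_pull (@edge_sym G) fS fe); exact: planar_no_K5_minor.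
Qed.

Lemma planar_sparse (S : {set G}) : (darts_in (@edge G) S <= 16 * #|S|)%N.
Proof.
have := @planar_contract_sparse id S (fun _ _ => erefl) (fun x _ => or_introl erefl).
apply: leq_trans; apply: leq_sum => x xS; apply/subset_leq_card/fintype.subsetP => y.
rewrite !inE => /andP[-> xy]; apply/contractP; split; last by exists x, y.
by apply: contraTneq xy => ->; rewrite edge_irr.
Qed.

End PlanarObstructions.

(** * Two vertices are adjacent to almost all others *)

Section Hubs.
Variables (R : realType) (G : sgraph).
Hypothesis planarG : planar R G.
Variables (x : G -> R) (rho : R).
Hypothesis x_ge0 : forall v, 0 <= x v.
Hypothesis x_le1 : forall v, x v <= 1.
Hypothesis rho_x : forall v, rho * x v <= \sum_(w | edge v w) x w.

Let nG : R := #|G|%:R.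
Let deg (v : G) := #|[set w | edge v w]|.

Lemma deg_le v : (deg v)%:R <= nG.
Proof. by rewrite ler_nat max_card. Qed.

Lemma sum_deg : \sum_v (deg v)%:R <= 16 * nG :> R.
Proof.
rewrite -natr_sum -natrM ler_nat -[X in (_ <= _ * X)%N]cardsT.
apply: leq_trans (planar_sparse planarG [set: G]).
rewrite /darts_in (eq_bigl (fun y => y \in [set: G])) => [|y]; last by rewrite inE.
apply: leq_sum => y _; apply/subset_leq_card/fintype.subsetP => w.
by rewrite !inE.
Qed.

Section TwoStep.
Variable eps : R.
Hypothesis eps0 : 0 < eps.
Hypothesis rho0 : 0 < rho.

Let L := [set v | eps <= x v].

(** A heavy vertex [v] has degree at least [rho * x v], hence at least [eps * rho], while the
    degrees add up to at most 16n. *)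
Lemma card_heavy : eps * rho * #|L|%:R <= 16 * nG.
Proof.
apply: le_trans sum_deg; rewrite mulr_natr -sumr_const.
apply: le_trans (_ : \sum_(v in L) (deg v)%:R <= _); last first.
  rewrite [leRHS](bigID (mem L)) /= lerDl; apply: sumr_ge0 => v _; exact: ler0n.
apply: ler_sum => v; rewrite inE => epsv.
apply: (@le_trans _ _ (rho * x v)); first by rewrite mulrC ler_wpM2l // ltW.
apply: le_trans (rho_x v) _; rewrite /deg -sum1_card natr_sum.
rewrite [leRHS](eq_bigl (fun w => edge v w)) => [|w]; last by rewrite inE.
by apply: ler_sum => w _; exact: x_le1.
Qed.

Section Branching.
Variable v : G.
Let L' := L :\ v.
Let branch y := #|[set w in L' | edge y w]|.
Let Y := [set y | edge v y && (1 < branch y)%N].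

(* Contract every light vertex of [Y] into one heavy neighbour; since [v] and two
   heavy vertices have at most two common neighbours, each edge of the resulting
   planar graph on the heavy vertices comes from at most two vertices of [Y]. *)
Lemma card_branching : (#|Y :\: L| <= 32 * #|L|)%N.
Proof.
have ab y : exists p : G * G, y \in Y ->
    [/\ p.1 \in L', p.2 \in L', p.1 != p.2, edge y p.1 & edge y p.2].
  have [|_] := boolP (y \in Y); last by exists (v, v).
  rewrite inE => /andP[_ /card_gt1P[a [b [+ + ab]]]].
  rewrite !inE -/L' => /andP[aL ya] /andP[bL yb].
  by exists (a, b); rewrite !inE.
have [p pP] := boolp.choice ab.
pose f y := if y \in Y :\: L then (p y).1 else y.
have sub : (#|L'| <= #|L|)%N by apply/subset_leq_card/finset.subsetDl.
have fL : {in L', forall w, f w = w}.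
  by move=> w; rewrite /f !inE => /andP[_ ->].
have sparse : (darts_in (contract edge f) L' <= 16 * #|L'|)%N.
  apply: (planar_contract_sparse planarG) => // y; rewrite /f.
  case: ifP => [/finset.setDP[/pP[_ _ _ ya _] _] _|_ _]; first by right.
  by left.
suff : (#|Y :\: L| <= 2 * darts_in (contract edge f) L')%N by lia.
rewrite -sum1_card (partition_big (fun y => (p y).1) (mem L')) /=; last first.
  by move=> y /finset.setDP[/pP[]].
rewrite /darts_in big_distrr /=; apply: leq_sum => a aL'.
rewrite /deg_in -sum1_card big_distrr /=.
rewrite (partition_big (fun y => (p y).2) (mem [set b in L' | contract edge f a b])) /=.
  apply: leq_sum => b; rewrite inE => /andP[bL' /contractP[nab _]].
  rewrite muln1 sum1_card.
  have [va vb] : v != a /\ v != b.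
    by move: aL' bL'; rewrite !inE => /andP[+ _] /andP[+ _]; rewrite ![_ == v]eq_sym.
  have un : uniq [:: v; a; b] by rewrite /= !inE negb_or va vb nab.
  apply: leq_trans (planar_no_K33 planarG un).
  apply/subset_leq_card/fintype.subsetP => y.
  rewrite [in X in X -> _]unfold_in => /andP[/andP[/finset.setDP[yY _] /eqP ya] /eqP yb].
  have [_ _ _ e1 e2] := pP y yY; rewrite inE -ya -yb !(edge_sym _ y) e1 e2 !andbT.
  by move: yY; rewrite inE (edge_sym v) => /andP[].
move=> y /andP[yYL /eqP ya]; have /finset.setDP[/pP[pa pb pab e1 e2] _] := yYL.
rewrite inE pb /=; apply/contractP; rewrite -ya; split=> //.
have fy : f y = (p y).1 by rewrite /f yYL.
by exists y, (p y).2; rewrite fy fL.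
Qed.

(** 528 = 16 * (32 + 1): the edges counted lie inside [Y :|: L], which has at most 33 times as many
    vertices as [L]. *)
Lemma sum_branching : (\sum_(y in Y) branch y <= 528 * #|L|)%N.
Proof.
apply: (@leq_trans (darts_in edge (Y :|: L))).
  rewrite /darts_in [X in (_ <= X)%N](bigID (mem Y)) /=.
  apply: leq_trans (leq_addr _ _).
  rewrite [X in (_ <= X)%N](eq_bigl (mem Y)) => [|y]; last first.
    by rewrite inE /=; case: (y \in Y); rewrite ?andbF.
  apply: leq_sum => y _; apply/subset_leq_card/fintype.subsetP => w.
  by rewrite !inE => /andP[/andP[_ ->] ->]; rewrite orbT.
apply: leq_trans (planar_sparse planarG _) _.
have : (#|Y :|: L| <= #|Y :\: L| + #|L|)%N.
  apply: leq_trans (leq_card_setU _ _); apply/subset_leq_card/fintype.subsetP => y.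
  by rewrite !inE; case: (eps <= x y); rewrite ?orbT ?orbF.
by have := card_branching; lia.
Qed.

(* Expand [rho ^+ 2 * x v] over walks of length two from [v]: only the walks
   returning to [v] and those ending in the single heavy neighbour of a
   non-branching vertex matter. *)
Lemma two_step mu : 0 <= mu -> (forall w, w != v -> x w <= mu) ->
  rho ^+ 2 * x v <= (deg v)%:R * (x v + mu) + (eps * (16 * nG) + 528 * #|L|%:R).
Proof.
move=> mu0 xmu.
have step y : edge v y -> \sum_(w | edge y w) x w <=
    (x v + mu) + eps * (deg y)%:R + (if y \in Y then (branch y)%:R else 0).
  move=> vy; rewrite (bigD1 v) /=; last by rewrite edge_sym.
  rewrite -!addrA lerD2l (bigID (fun w => w \in L)) /= addrA addrAC.
  apply: lerD; last first.
    apply: (@le_trans _ _ (\sum_(w in [set w | edge y w]) eps)); last first.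
      by rewrite sumr_const mulr_natr.
    rewrite big_mkcond [leRHS]big_mkcond /=; apply: ler_sum => w _.
    rewrite !inE; case: ifP => [/andP[/andP[-> _]]|_]; first by rewrite -ltNge => /ltW.
    by case: ifP => // _; exact: ltW.
  rewrite (eq_bigl (fun w => w \in [set w in L' | edge y w])) => [|w]; last first.
    by rewrite !inE; case: (w == v); rewrite ?andbF //= andbT andbC.
  rewrite inE vy /= -/(branch y); case: ltnP => b1.
    rewrite -[leLHS]add0r; apply: lerD => //; rewrite /branch -sum1_card natr_sum.
    by apply: ler_sum => w _; exact: x_le1.
  rewrite addr0; move: b1; rewrite /branch.
  case: (posnP #|[set w in L' | edge y w]|) => [/cards0_eq-> _|b0 b1].
    by rewrite big_set0.
  have /eqP/cards1P[w wE] : #|[set w in L' | edge y w]| = 1%N by lia.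
  rewrite wE big_set1; apply: xmu.
  have : w \in [set w in L' | edge y w] by rewrite wE inE.
  by rewrite !inE => /andP[/andP[]].
rewrite expr2 -mulrA; apply: le_trans (ler_wpM2l (ltW rho0) (rho_x v)) _.
rewrite big_distrr /=.
apply: le_trans (ler_sum _ (fun y vy => le_trans (rho_x y) (step y vy))) _.
rewrite big_split /= big_split /= -!addrA lerD //.
  rewrite (eq_bigl (fun y => y \in [set w | edge v w])) => [|y]; last by rewrite inE.
  by rewrite sumr_const mulr_natl.
rewrite lerD //.
  rewrite -mulr_sumr ler_wpM2l ?(ltW eps0) //; apply: le_trans sum_deg.
  by rewrite [leRHS](bigID (edge v)) /= lerDl; apply: sumr_ge0 => w _; exact: ler0n.
rewrite -big_mkcondr /= -natrM; apply: (@le_trans _ _ (\sum_(y in Y) branch y)%:R);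
  last by rewrite ler_nat; exact: sum_branching.
rewrite natr_sum (eq_bigl (fun y => y \in Y)) // => y.
by rewrite inE; case: (edge v y).
Qed.

End Branching.

(** By [card_heavy] and the lower bound on [rho], the term with 528 is at most [eps * (16 * nG)]
    too. *)
Lemma two_step_small v mu : 528 <= eps ^+ 2 * rho ->
  0 <= mu -> (forall w, w != v -> x w <= mu) ->
  rho ^+ 2 * x v <= (deg v)%:R * (x v + mu) + 32 * eps * nG.
Proof.
move=> big mu0 xmu; apply: le_trans (two_step mu0 xmu) _; rewrite lerD2l.
have h1 := card_heavy.
have h2 : 528 * #|L|%:R <= eps * (16 * nG).
  apply: (@le_trans _ _ (eps ^+ 2 * rho * #|L|%:R)); first by rewrite ler_wpM2r.
  by rewrite expr2 -!mulrA ler_wpM2l ?(ltW eps0) // mulrA.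
by lra.
Qed.

(** Three uses of [two_step_small]: at [u] with [mu = 1], for the degree of [u]; at [u] with
    [mu = x v], the largest other weight, which forces [x v] close to 1; and at [v] with [mu = 1],
    for the degree of [v]. The degree deficits 16 [eps] n and 48 [eps] n add up to 64 [eps] n. *)
Lemma hubs u : 528 <= eps ^+ 2 * rho -> 32 * eps < 1 -> 2 * nG <= rho ^+ 2 -> x u = 1 ->
  exists v, [/\ v != u, 1 - 32 * eps <= x v &
    nG - #|[set w | edge u w && edge v w]|%:R <= 64 * eps * nG].
Proof.
move=> big eps1 rho2 xu.
have n0 : 0 < nG by rewrite ltr0n; apply/card_gt0P; exists u.
have du := deg_le u.
have e0 : 0 < eps * nG by rewrite mulr_gt0.
have en1 : 32 * (eps * nG) < nG by rewrite mulrA gtr_pMl.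
have du2 : 2 * nG <= 2 * (deg u)%:R + 32 * (eps * nG).
  have := two_step_small big ler01 (fun w _ => x_le1 w : x w <= 1); move=> /(_ u).
  by rewrite xu mulr1; lra.
have [w0 w0u] : exists w, w != u.
  have : (0 < deg u)%N by rewrite -(ltr_nat R); lra.
  move=> /card_gt0P[w]; rewrite inE => uw; exists w.
  by apply: contraTneq uw => ->; rewrite edge_irr.
pose v := [arg max_(w > w0 | w != u) x w]%O.
have [vu vmax] : v != u /\ forall w, w != u -> x w <= x v.
  by rewrite /v; case: arg_maxP.
have xv : 1 - 32 * eps <= x v.
  have := two_step_small big (x_ge0 v) vmax; rewrite xu mulr1 => h.
  have : (deg u)%:R * (1 + x v) <= nG * (1 + x v) by rewrite ler_wpM2r // addr_ge0.
  move=> h'; rewrite -(ler_pM2l n0); lra.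
exists v; split => //.
have dv : 2 * nG - 96 * (eps * nG) <= 2 * (deg v)%:R.
  have := two_step_small big ler01 (fun w _ => x_le1 w : x w <= 1); move=> /(_ v).
  have h1 : 2 * nG * (1 - 32 * eps) <= rho ^+ 2 * x v.
    by apply: ler_pM => //; lra.
  have h2 : (deg v)%:R * (x v + 1) <= (deg v)%:R * 2 :> R.
    by rewrite ler_wpM2l //; have := x_le1 v; lra.
  by lra.
have : (deg u + deg v <= #|[set w | edge u w && edge v w]| + #|G|)%N.
  rewrite /deg -cardsUI addnC leq_add ?max_card //.
  by apply/subset_leq_card/fintype.subsetP => w; rewrite !inE.
rewrite -(ler_nat R) !natrD -/nG => h; lra.
Qed.

End TwoStep.
End Hubs.

(** * Two vertices are adjacent to all others *)

Section TwoHubs.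
Variables (R : realType) (G : sgraph).
Hypothesis planarG : planar R G.
(* Unqualified, [free] is the freeness of families of vectors. *)
Hypothesis freeG : Defs.free K5_minus_e G.
Variables (x : G -> R) (rho : R).
Hypothesis x_ge0 : forall v, 0 <= x v.
Hypothesis x_le1 : forall v, x v <= 1.
Hypothesis rho_x : forall v, rho * x v <= \sum_(w | edge v w) x w.
Variables (u v : G).
Hypothesis vu : v != u.

Let nG : R := #|G|%:R.
Let A : {set G} := [set w | edge u w && edge v w].
Let B : {set G} := ~: [set u; v] :\: A.
Let XA := \sum_(w in A) x w.
Let XB := \sum_(w in B) x w.
Let s := x u + x v.

(** The outcome of [hubs] for 32 [eps] = 1/400, with the quadratic equation that defines [rho]. *)
Hypothesis hubsP : [/\ x u = 1, 1 - 400^-1 <= x v, 100 <= rho,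
  rho ^+ 2 - 2 * rho = 2 * nG - 4 & nG - #|A|%:R <= 200^-1 * nG].

Lemma xu : x u = 1. Proof. by case: hubsP. Qed.
Lemma xv : 1 - 400^-1 <= x v. Proof. by case: hubsP. Qed.
Lemma rho100 : 100 <= rho. Proof. by case: hubsP. Qed.
Lemma rhoE : rho ^+ 2 - 2 * rho = 2 * nG - 4. Proof. by case: hubsP. Qed.
Lemma card_common : nG - #|A|%:R <= 200^-1 * nG. Proof. by case: hubsP. Qed.

Lemma rho_gt0 : 0 < rho.
Proof. exact: lt_le_trans rho100. Qed.

Lemma A_out w : w \in A -> (w != u) && (w != v).
Proof.
rewrite inE => /andP[uw vw]; apply/andP; split.
  by apply: contraTneq uw => ->; rewrite edge_irr.
by apply: contraTneq vw => ->; rewrite edge_irr.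
Qed.

Lemma card_G : nG = 2 + #|A|%:R + #|B|%:R.
Proof.
rewrite /nG -!natrD -cardsT; congr _%:R.
rewrite (cardsD1 u) (cardsD1 v) !inE vu /= -addnA; congr (_ + (_ + _))%N.
rewrite -(cardsID A (_ :\ v)); congr (_ + _)%N; apply: eq_card => w; rewrite !inE.
  have := @A_out w; rewrite !inE; case: (_ && _) => [/(_ isT)/andP[-> ->]|] //.
  by rewrite andbF.
by rewrite !andbT negb_or [(w != u) && _]andbC.
Qed.

Lemma nbr_split w : \sum_(y | edge w y) x y =
  (if edge w u then x u else 0) + (if edge w v then x v else 0) +
  \sum_(y in A | edge w y) x y + \sum_(y in B | edge w y) x y.
Proof.
rewrite big_mkcond (bigD1 u) //= (bigD1 v) //= -!addrA; congr (_ + (_ + _)).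
rewrite (bigID (fun y => y \in A)) /= -2!big_mkcondr /=; congr (_ + _); apply: eq_bigl => y.
  have := @A_out y; rewrite !inE; case: (edge u y && _) => [/(_ isT)->|] //.
  by rewrite !andbF.
by rewrite !inE negb_or [(~~ (edge u y && _)) && _]andbC.
Qed.

Lemma sum_nbr_exchange (C D : {set G}) :
  \sum_(w in C) \sum_(y in D | edge w y) x y =
  \sum_(y in D) (deg_in edge C y)%:R * x y.
Proof.
rewrite (exchange_big_dep (mem D)) /=; last by move=> w y _ /andP[].
apply: eq_bigr => y yD; rewrite mulr_natl -sumr_const; apply: eq_bigl => w.
by rewrite !inE yD /= edge_sym.
Qed.

Lemma deg_A_le2 w : w != u -> w != v -> (deg_in edge A w <= 2)%N.
Proof.
move=> wu wv; have un : uniq [:: u; v; w].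
  by rewrite /= !inE negb_or ![_ == w]eq_sym wu wv eq_sym vu.
apply: leq_trans (planar_no_K33 planarG un); apply/subset_leq_card/fintype.subsetP => y.
by rewrite !inE => /andP[/andP[-> ->] ->].
Qed.

Lemma sum_nbr_le (C : {set G}) w (M : R) : 0 <= M ->
  (forall y, y \in C -> x y <= M) ->
  \sum_(y in C | edge w y) x y <= (deg_in edge C w)%:R * M.
Proof.
move=> M0 xM; rewrite mulr_natl -sumr_const.
rewrite [leRHS](eq_bigl (fun y => (y \in C) && edge w y)) => [|y]; last by rewrite inE.
by apply: ler_sum => y /andP[/xM].
Qed.

Lemma B_hub w : w \in B ->
  (if edge w u then x u else 0) + (if edge w v then x v else 0) <= 1.
Proof.
rewrite !inE -!(edge_sym w) => /andP[+ _].
by case: (edge w u); case: (edge w v) => //= _;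
  rewrite ?addr0 ?add0r ?x_le1 ?ler01.
Qed.

Lemma B_out w : w \in B -> (w != u) && (w != v).
Proof. by rewrite !inE negb_or => /andP[]. Qed.

Lemma sum_deg_B : \sum_(w in B) (deg_in edge B w)%:R <= 16 * #|B|%:R :> R.
Proof. by rewrite -natr_sum -natrM ler_nat; exact: planar_sparse planarG _. Qed.

Lemma B_step w : w \in B -> rho * x w <= 3 + (deg_in edge B w)%:R.
Proof.
move=> wB; apply: le_trans (rho_x w) _; rewrite nbr_split.
have /andP[wu wv] := B_out wB.
have h1 := B_hub wB; have h2 := sum_nbr_le w ler01 (fun y (_ : y \in A) => x_le1 y).
have h3 := sum_nbr_le w ler01 (fun y (_ : y \in B) => x_le1 y).
have h4 : (deg_in edge A w)%:R <= 2 :> R by rewrite ler_nat deg_A_le2.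
by move: h1 h2 h3 h4; rewrite !mulr1; lra.
Qed.

(** One expansion gives at most 4 plus the weight of the neighbours in [B], and that weight is at
    most 19 * |B| / [rho]. Since |B| is at most [rho ^+ 2] / 400, the weight is at most 4/100 +
    19/400 < 1/10. *)
Lemma x_small w : w != u -> w != v -> x w <= 10^-1.
Proof.
move=> wu wv; have rho0 := rho_gt0.
have h1 : rho * x w <= 4 + \sum_(y in B | edge w y) x y.
  apply: le_trans (rho_x w) _; rewrite nbr_split lerD2r.
  have h2 := sum_nbr_le w ler01 (fun y (_ : y \in A) => x_le1 y).
  have h4 : (deg_in edge A w)%:R <= 2 :> R by rewrite ler_nat deg_A_le2.
  have h5 (b : bool) (y : G) : (if b then x y else 0) <= 1 by case: b.
  have := h5 (edge w u) u; have := h5 (edge w v) v; move: h2 h4; rewrite mulr1; lra.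
have h2 : rho * (\sum_(y in B | edge w y) x y) <= 19 * #|B|%:R.
  rewrite big_distrr /=.
  apply: (@le_trans _ _ (\sum_(y in B) (3 + (deg_in edge B y)%:R))).
    rewrite big_mkcondr; apply: ler_sum => y yB; case: ifP => _; first exact: B_step.
    by rewrite addr_ge0.
  rewrite big_split /= sumr_const -[X in X + _]mulr_natr; have := sum_deg_B; lra.
have h3 : rho ^+ 2 * x w <= 4 * rho + 19 * #|B|%:R.
  rewrite expr2 -mulrA; have := ler_wpM2l (ltW rho0) h1; move: h2; lra.
have h4 : #|B|%:R <= 400^-1 * rho ^+ 2.
  have := card_G; have := card_common; have := rhoE; have := rho_gt0; lra.
have h5 : 100 * rho <= rho ^+ 2 by rewrite expr2 ler_pM2r // rho100.
by rewrite -(ler_pM2l (exprn_gt0 2 rho0)); move: h3 h4 h5; lra.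
Qed.

(** The constant must stay clearly below 2 * [s], about 4, for the comparisons below. [B_step] alone
    would give 19; inserting [x_small] into the same expansion gives 1 + 2/10 + 16/10 < 3. *)
Lemma XB_le : rho * XB <= 3 * #|B|%:R.
Proof.
rewrite big_distrr /=.
apply: (@le_trans _ _ (\sum_(w in B) ((1 + 5^-1) + 10^-1 * (deg_in edge B w)%:R))).
  apply: ler_sum => w wB; apply: le_trans (rho_x w) _; rewrite nbr_split.
  have /andP[wu wv] := B_out wB.
  have M0 : 0 <= 10^-1 :> R by rewrite invr_ge0 ler0n.
  have h1 := B_hub wB.
  have h2 := sum_nbr_le w M0 (fun y yA => let: conj a b := andP (A_out yA) in x_small a b).
  have h3 := sum_nbr_le w M0 (fun y yA => let: conj a b := andP (B_out yA) in x_small a b).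
  have h4 : (deg_in edge A w)%:R <= 2 :> R by rewrite ler_nat deg_A_le2.
  by move: h1 h2 h3 h4; lra.
rewrite big_split /= sumr_const -mulr_sumr -[(_ + _) *+ _]mulr_natr.
by have := ler0n R #|B|; have := sum_deg_B; lra.
Qed.

(** Kept apart from [rho * x w]: the gap between the two is exploited at a vertex of weight 0 in
    [rest_two_regular]. *)
Let nbrs w := s + \sum_(y in A | edge w y) x y + \sum_(y in B | edge w y) x y.

Lemma A_nbrs w : w \in A -> rho * x w <= nbrs w.
Proof.
rewrite inE => /andP[uw vw]; apply: le_trans (rho_x w) _.
by rewrite nbr_split !(edge_sym w) uw vw.
Qed.

(** After exchanging sums, a weight in [B] is counted once per neighbour in [A], so at most
    twice. *)
Lemma sum_nbrs : \sum_(w in A) nbrs w <=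
  #|A|%:R * s + \sum_(w in A) (deg_in edge A w)%:R * x w + 2 * XB.
Proof.
rewrite /nbrs big_split /= big_split /= !sum_nbr_exchange sumr_const -[s *+ _]mulr_natl lerD2l.
rewrite mulr_sumr; apply: ler_sum => w /B_out/andP[wu wv].
by rewrite ler_wpM2r // ler_nat deg_A_le2.
Qed.

Lemma XA_step : rho * XA <=
  #|A|%:R * s + \sum_(w in A) (deg_in edge A w)%:R * x w + 2 * XB.
Proof.
apply: le_trans sum_nbrs; rewrite big_distrr /=; apply: ler_sum; exact: A_nbrs.
Qed.

(** A vertex of [A] is seen by both hubs, a vertex of [B] by at most one. *)
Lemma hub_step : rho * s <= (if edge u v then s else 0) + 2 * XA + XB.
Proof.
rewrite /s mulrDr; apply: le_trans (lerD (rho_x u) (rho_x v)) _.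
rewrite !nbr_split !edge_irr (edge_sym v u).
have hA w : w \in [set u; v] -> \sum_(y in A | edge w y) x y <= XA.
  by move=> _; rewrite big_mkcondr; apply: ler_sum => y _; case: ifP.
have hB : \sum_(y in B | edge u y) x y + \sum_(y in B | edge v y) x y <= XB.
  rewrite [X in X + _]big_mkcondr [X in _ + X]big_mkcondr /= -big_split /=.
  apply: ler_sum => y; rewrite !inE => /andP[+ _].
  by case: (edge u y); case: (edge v y) => //= _; rewrite ?addr0 ?add0r.
have := hA u; have := hA v; rewrite !inE !eqxx orbT => /(_ isT) h1 /(_ isT) h2.
by case: ifP => _; move: h1 h2 hB; lra.
Qed.

Lemma s_bounds : 2 - 400^-1 <= s.
Proof. by rewrite /s xu; have := xv; lra. Qed.

(** If the hubs were adjacent, [A] would induce a matching, so [rho - 1] would replace [rho] in the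
    hub inequality and [rho - 2] in that for [A]. But (rho - 1)^2 = 2(n - 2) + 1, and the extra 1 is
    a contradiction even when [B] is empty. *)
Lemma hubs_nonadjacent : ~~ edge u v.
Proof.
apply/negP => uv.
have deg1 w : w \in A -> (deg_in edge A w <= 1)%N.
  move=> wA; rewrite leqNgt; apply/negP => /card_gt1P[y1 [y2 []]].
  move=> y1A y2A y12; apply: freeG.
  have wE : edge u w && edge v w by move: wA; rewrite inE.
  have [/andP[uw vw] y1E y2E] : [/\ edge u w && edge v w,
     [&& edge u y1, edge v y1 & edge w y1] & [&& edge u y2, edge v y2 & edge w y2]].
    by move: y1A y2A; rewrite !inE -!andbA.
  move: y1E y2E => /and3P[e1 e2 e3] /and3P[e4 e5 e6].
  have ne (a b : G) : edge a b -> a != b.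
    by apply: contraTneq => ->; rewrite edge_irr.
  (* [y1] and [y2] take the places 0 and 1, the ends of the missing edge. *)
  pose f (i : 'I_5) := nth u [:: y1; y2; u; v; w] i.
  have unf : uniq [:: y1; y2; u; v; w].
    rewrite /= !inE !negb_or y12 /= ![y1 == _]eq_sym ![y2 == _]eq_sym !ne //.
  exists f; first by move=> i j /eqP; rewrite nth_uniq // => /eqP/val_inj.
  move=> [i i5] [j j5]; rewrite /= /K5_minus_e_edge /f -val_eqE /=.
  case: i i5 => [|[|[|[|[|//]]]]] _; case: j j5 => [|[|[|[|[|//]]]]] _ //= _;
    by rewrite // edge_sym.
have rho0 := rho_gt0.
have hs := s_bounds; have hX := XB_le.
have XB0 : 0 <= XB by apply: sumr_ge0.
have h1 : (rho - 1) * XA <= #|A|%:R * s + 2 * XB.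
  have : \sum_(w in A) (deg_in edge A w)%:R * x w <= XA.
    apply: ler_sum => w wA; rewrite -[leRHS]mul1r ler_wpM2r //.
    by rewrite (ler_nat R _ 1) deg1.
  move=> h; have := XA_step; move: h; lra.
have h2 : (rho - 1) * s <= 2 * XA + XB by have := hub_step; rewrite uv; lra.
have h3 : (rho - 1) * ((rho - 1) * s) <= (rho - 1) * (2 * XA + XB).
  by rewrite ler_pM2l // subr_gt0 (lt_le_trans _ rho100) // ?ltr1n ?ltr_nat.
have h4 : (rho - 1) * ((rho - 1) * s) = (2 * #|A|%:R + 2 * #|B|%:R + 1) * s.
  rewrite mulrA; congr (_ * _).
  have -> : (rho - 1) * (rho - 1) = rho ^+ 2 - 2 * rho + 1 by ring.
  by rewrite rhoE card_G; ring.
have h5 : 100 * XB <= rho * XB by rewrite ler_wpM2r // rho100.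
have B0 : 0 <= #|B|%:R :> R by [].
have h6 : #|B|%:R * (2 - 400^-1) <= #|B|%:R * s by rewrite ler_wpM2l.
by move: h1 h2 h3 h4 h5 h6 hs hX XB0 B0; lra.
Qed.

(* A vertex of [B] counts for [2 * s] in [rho * (rho - 2) * s = 2 * (n - 2) * s],
   but contributes only about [1] to [(rho + 2) * XB]. *)
Lemma common_all w : w != u -> w != v -> w \in A.
Proof.
move=> wu wv; apply: contraT => wA.
have wB : w \in B by rewrite finset.in_setD wA !inE negb_or wu.
have B1 : 1 <= #|B|%:R :> R by rewrite ler1n; apply/card_gt0P; exists w.
have rho0 := rho_gt0.
have hs := s_bounds; have hX := XB_le.
have XB0 : 0 <= XB by apply: sumr_ge0.
have h1 : (rho - 2) * XA <= #|A|%:R * s + 2 * XB.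
  have : \sum_(w in A) (deg_in edge A w)%:R * x w <= 2 * XA.
    rewrite mulr_sumr; apply: ler_sum => y /A_out/andP[yu yv].
    by rewrite ler_wpM2r // ler_nat deg_A_le2.
  move=> h; have := XA_step; move: h; lra.
have h2 : rho * s <= 2 * XA + XB.
  by have := hub_step; rewrite (negPf hubs_nonadjacent) add0r.
have h3 : (rho - 2) * (rho * s) <= (rho - 2) * (2 * XA + XB).
  by rewrite ler_pM2l // subr_gt0 (lt_le_trans _ rho100) // ?ltr1n ?ltr_nat.
have h4 : (rho - 2) * (rho * s) = (2 * #|A|%:R + 2 * #|B|%:R) * s.
  rewrite mulrA; congr (_ * _).
  have -> : (rho - 2) * rho = rho ^+ 2 - 2 * rho by ring.
  by rewrite rhoE card_G; ring.
have h5 : 100 * XB <= rho * XB by rewrite ler_wpM2r // rho100.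
have h6 : #|B|%:R * (2 - 400^-1) <= #|B|%:R * s by rewrite ler_wpM2l.
by move: h1 h2 h3 h4 h5 h6 hs hX XB0 B1; lra.
Qed.

(* With [B] empty all the inequalities leading to [XA_step] are equalities. *)
Lemma rest_two_regular w : w != u -> w != v -> deg_in edge A w = 2%N.
Proof.
move=> wu wv; apply/eqP; rewrite eqn_leq deg_A_le2 //= leqNgt; apply/negP => dw.
have B0 : #|B| = 0%N.
  apply: eq_card0 => y; apply/negP => yB; have /andP[yu yv] := B_out yB.
  by have := common_all yu yv; move: yB; rewrite inE => /andP[/negPf->].
have XB0 : XB = 0 by rewrite /XB (cards0_eq B0) big_set0.
have wA := common_all wu wv.
have hs := s_bounds; have rho0 := rho_gt0.
have h2 : rho * s <= 2 * XA.
  by have := hub_step; rewrite (negPf hubs_nonadjacent) add0r XB0 addr0.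
have h3 : (rho - 2) * (rho * s) <= (rho - 2) * (2 * XA).
  by rewrite ler_pM2l // subr_gt0 (lt_le_trans _ rho100) // ?ltr1n ?ltr_nat.
have h4 : (rho - 2) * (rho * s) = 2 * #|A|%:R * s.
  rewrite mulrA; congr (_ * _).
  have -> : (rho - 2) * rho = rho ^+ 2 - 2 * rho by ring.
  by rewrite rhoE card_G B0; ring.
have degx y : y \in A -> (deg_in edge A y)%:R * x y <= 2 * x y.
  by move=> /A_out/andP[yu yv]; rewrite ler_wpM2r // ler_nat deg_A_le2.
have h5 : \sum_(y in A) (deg_in edge A y)%:R * x y <= 2 * XA - x w.
  rewrite /XA mulr_sumr !(bigD1 w wA) /= addrAC; apply: lerD.
    have : (deg_in edge A w)%:R * x w <= 1 * x w by rewrite ler_wpM2r // (ler_nat R _ 1).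
    by move=> /le_trans; apply; rewrite mulr2n mulrDl !mul1r addrK.
  by apply: ler_sum => y /andP[/degx].
(* The inequalities already meet without the saving of [x w] in [h5], so this saving is 0. *)
have xw0 : x w = 0.
  have := XA_step; have := x_ge0 w; rewrite XB0; move: h3 h4 h5; move=> *.
  apply/eqP; rewrite eq_le; apply/andP; split; lra.
(* A vertex of weight 0 still sees both hubs: [nbrs w] exceeds [rho * x w] by at least [s], a gap
   for which there is no room. *)
have : rho * XA + s <= \sum_(y in A) nbrs y.
  rewrite /XA mulr_sumr !(bigD1 w wA) /= xw0 mulr0 add0r [leLHS]addrC; apply: lerD.
    by rewrite /nbrs -addrA lerDl addr_ge0 // sumr_ge0.
  by apply: ler_sum => y /andP[/A_nbrs].
have := sum_nbrs; rewrite XB0; move: h3 h4 h5 hs xw0 (x_ge0 w); lra.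
Qed.

End TwoHubs.

(** * The remaining vertices form a cycle *)

Section TwoRegular.
Variables (T : finType) (e : rel T) (A : {set T}).
Hypothesis e_sym : symmetric e.
Hypothesis e_irr : irreflexive e.
Hypothesis deg2 : {in A, forall w, deg_in e A w = 2%N}.

Lemma uniq_leq_card (s : seq T) (C : {set T}) :
  uniq s -> {subset s <= C} -> (size s <= #|C|)%N.
Proof.
by move=> /card_uniqP<- sC; apply/subset_leq_card/fintype.subsetP.
Qed.

(* A longest path: all neighbours of its first vertex lie on it, and the one
   that is not the second vertex can only be the last one. *)
Lemma two_regular_cycle : A != finset.set0 ->
  exists s, [/\ uniq s, {subset s <= A}, (3 <= size s)%N & cycle e s].
Proof.
move=> /finset.set0Pn[w wA].
pose good s := [&& uniq s, all (mem A) s & sorted e s].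
pose P k := [exists t : k.-tuple T, good t].
have P1 : P 1%N by apply/existsP; exists [tuple w]; rewrite /good /= wA.
have Pmax k : P k -> (k <= #|A|)%N.
  case/existsP => t /and3P[ut /allP At _]; rewrite -(size_tuple t).
  exact: uniq_leq_card.
case: (ex_maxnP (ex_intro P 1%N P1) Pmax) => k /existsP[t gt] kmax.
have k1 := kmax _ P1.
have tmax s : good s -> (size s <= k)%N.
  by move=> gs; apply: kmax; apply/existsP; exists (in_tuple s).
move: gt (size_tuple t) k1; case: (tval t) => [_ <- //|x p gxp szp _].
have /and3P[/= /andP[xp up] /andP[xA /allP pA] ep] := gxp.
have nbrs y : y \in A -> e x y -> y \in p.
  move=> yA xy; have : y \in x :: p.
    apply: contraT => yp; have /tmax : good (y :: x :: p).
      by rewrite /good /= e_sym xy ep yA xA yp xp up /= andbT; apply/allP.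
    by rewrite /= -szp ltnn.
  by rewrite inE; case: eqP => [yx|//]; rewrite yx e_irr in xy.
have /card_gt1P[a [b [+ + ab]]] : (1 < deg_in e A x)%N by rewrite deg2.
rewrite !inE => /andP[aA xa] /andP[bA xb].
have := nbrs _ aA xa; case: p => // y p in xp up pA ep nbrs tmax gxp szp * => _.
have [z [zA xz zy]] : exists z, [/\ z \in A, e x z & z != y].
  have [ay|ny] := eqVneq a y; last by exists a.
  by exists b; split; rewrite // -ay eq_sym.
have zp : z \in p by have := nbrs z zA xz; rewrite inE (negPf zy).
case/splitPr: zp => p1 p2 in xp up pA ep nbrs tmax gxp szp *.
case: p2 => [|r p2] in xp up pA ep nbrs tmax gxp szp *.
  exists [:: x, y & p1 ++ [:: z]]; split.
  - by case/and3P: gxp.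
  - by move=> c; rewrite inE => /orP[/eqP->//|/pA].
  - by rewrite /= size_cat addn1.
  - rewrite (cycle_path x) /= last_cat /= e_sym xz.
    exact: ep.
(* Otherwise [z] is interior to the path and has three neighbours in [A]: [x] and its two neighbours
   along the path. *)
have := deg2 zA; suff : (2 < deg_in e A z)%N by move=> + dz; rewrite dz.
have [xA' rA lA] : [/\ x \in A, r \in A & last y p1 \in A].
  split=> //; apply: pA; rewrite inE mem_cat !inE ?eqxx ?orbT //.
  by have := mem_last y p1; rewrite inE => /orP[->|->]; rewrite ?orbT.
apply: (@uniq_leq_card [:: x; r; last y p1]).
  have xr : x != r by apply: contraNneq xp => ->; rewrite inE mem_cat !inE eqxx !orbT.
  have xl : x != last y p1.
    apply: contraNneq xp => ->; rewrite inE mem_cat.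
    by have := mem_last y p1; rewrite inE => /orP[->|->]; rewrite ?orbT.
  have rl : r != last y p1.
    move: up; rewrite -cat_cons cat_uniq => /and3P[_ /hasPn/(_ r) h _].
    by apply: contraTneq (mem_last y p1) => <-; apply: h; rewrite !inE eqxx orbT.
  by rewrite /= !inE negb_or xr xl rl.
have : path e x (y :: p1 ++ z :: r :: p2) by [].
rewrite /= cat_path /= => /and5P[_ _ lz zr _] c.
by rewrite !inE => /or3P[] /eqP->; rewrite ?xA' ?rA ?lA //= e_sym.
Qed.

End TwoRegular.

Lemma clique_minor_lt (T : finType) r (e : rel T) (S : {set T}) (phi : 'I_r -> {set T}) :
  symmetric e -> (forall i, phi i \subset S) -> (forall i, phi i != finset.set0) ->
  (forall i, connected_in e (phi i)) ->
  (forall i j : 'I_r, (i < j)%N -> [disjoint phi i & phi j]) ->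
  (forall i j : 'I_r, (i < j)%N -> exists x y, [/\ x \in phi i, y \in phi j & e x y]) ->
  clique_minor e S phi.
Proof.
move=> es sub ne conn disj adj; split=> // i j.
  by rewrite neq_ltn => /orP[/disj//|/disj]; rewrite disjoint_sym.
rewrite neq_ltn => /orP[/adj//|/adj[x [y [xj yi xy]]]].
by exists y, x; rewrite es.
Qed.

Lemma path_within (T : finType) (e : rel T) (W : {set T}) z p :
  path e z p -> {subset z :: p <= W} -> path (within e W) z p.
Proof.
elim: p z => //= d p IH z /andP[zd dp] sW.
rewrite /within /= zd !sW ?mem_head ?inE ?eqxx ?orbT //=; apply: IH dp _ => c cp.
by apply: sW; rewrite inE cp orbT.
Qed.

Lemma cycle_nth (T : Type) (e : rel T) x0 s i : cycle e s -> (i < size s)%N ->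
  e (nth x0 s i) (nth x0 s (i.+1 %% size s)).
Proof.
case: s => // x p /= /(pathP x0) h ip.
have := h i; rewrite size_rcons => /(_ ip); rewrite -rcons_cons !nth_rcons /= ip.
move: ip; rewrite ltnS leq_eqVlt => /orP[/eqP->|ip].
  by rewrite ltnn eqxx modnn.
by rewrite ip modn_small.
Qed.

Lemma isomorphic_sym (G H : sgraph) : isomorphic G H -> isomorphic H G.
Proof.
case=> f [g fK gK] fe; exists g; first by exists f.
by move=> a b; rewrite -fe !gK.
Qed.

Section Join.
Variables (R : realType) (G : sgraph) (u v : G).
Hypothesis planarG : planar R G.
Hypothesis uv : u != v.
Hypothesis nuv : ~~ edge u v.
Let A := [set w | edge u w && edge v w].
Hypothesis A_all : forall w, w != u -> w != v -> w \in A.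
Hypothesis deg2 : {in A, forall w, deg_in edge A w = 2%N}.

Lemma uvA w : w \in A -> [/\ edge u w, edge v w, w != u & w != v].
Proof.
rewrite inE => /andP[uw vw]; split=> //.
  by apply: contraTneq uw => ->; rewrite edge_irr.
by apply: contraTneq vw => ->; rewrite edge_irr.
Qed.

(** A vertex [w] of [A] off the cycle connects the nonadjacent hubs: {u, w} and {v} are adjacent
    branch sets, both joined to the triangle obtained by contracting the cycle to [x], [y] and the
    rest [Z]. *)
Lemma cycle_covers s : uniq s -> {subset s <= A} -> (3 <= size s)%N ->
  cycle edge s -> {subset A <= s}.
Proof.
case: s => [|x [|y [|z p]]] // us sA _ cs w wA; apply: contraT => ws.
have [uw vw wu wv] := uvA wA.
have E c : c \in [:: x, y, z & p] -> [/\ edge u c, edge v c, c != u & c != v].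
  by move=> /sA/uvA.
pose Z := [set c in z :: p].
pose phi (i : 'I_5) := nth finset.set0 [:: [set u; w]; [set v]; [set x]; [set y]; Z] i.
case: (@planar_no_K5_minor R G planarG [set: G] phi).
have xin : x \in [:: x, y, z & p] by rewrite inE eqxx.
have yin : y \in [:: x, y, z & p] by rewrite !inE eqxx orbT.
have pin c : c \in z :: p -> c \in [:: x, y, z & p].
  by rewrite !inE => /orP[]->; rewrite !orbT.
have [ux vx xu xv] := E x xin; have [uy vy yu yv] := E y yin.
have [uz vz zu zv] := E z (pin z (mem_head _ _)).
move: us => /= /and3P[xN yN _]; move: ws; rewrite !inE !negb_or => /and3P[wx wy wzp].
have xy : x != y by apply: contraNneq xN => ->; rewrite mem_head.
have xZ : x \notin Z by rewrite inE; apply: contra xN => h; rewrite inE h orbT.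
have yZ : y \notin Z by rewrite inE.
have uZ : u \notin Z by apply/negP; rewrite inE => /pin/E[_ _]; rewrite eqxx.
have vZ : v \notin Z by apply/negP; rewrite inE => /pin/E[_ _ _]; rewrite eqxx.
have wZ : w \notin Z by rewrite !inE negb_or.
move: cs; rewrite (cycle_path x) /= => /and4P[lx exy eyz ep].
have lZ : last z p \in Z by rewrite inE mem_last.
have zZ : z \in Z by rewrite inE mem_head.
have conn1 (a : G) : connected_in edge [set a].
  by move=> b c; rewrite !inE => /eqP-> /eqP->; exact: connect0.
have csym W : connect_sym (within (@edge G) W) by exact/sym_connect_sym/within_sym/edge_sym.
apply: clique_minor_lt; first exact: edge_sym.
- by move=> i; apply: finset.subsetT.
- move=> i; apply/finset.set0Pn; case: i => [[|[|[|[|[|//]]]]] hi]; rewrite /phi /=.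
  + by exists u; rewrite !inE eqxx.
  + by exists v; rewrite inE.
  + by exists x; rewrite inE.
  + by exists y; rewrite inE.
  + by exists z.
- case=> [[|[|[|[|[|//]]]]] hi]; rewrite /phi /=; try exact: conn1.
    have uwc : connect (within edge [set u; w]) u w.
      by apply: connect1; rewrite /within /= uw !inE !eqxx orbT.
    move=> a b; rewrite !inE => /orP[] /eqP-> /orP[] /eqP->; rewrite ?connect0 //.
    by rewrite csym.
  have zc c : c \in Z -> connect (within edge Z) z c.
    have pZ : path (within edge Z) z p.
      by apply: path_within ep _ => d dz; rewrite inE.
    by rewrite inE => cz; exact: path_connect pZ _ cz.
  by move=> a b /zc za /zc zb; apply: connect_trans zb; rewrite csym.
- move=> [i hi] [j hj]; rewrite /phi /=.
  have D1 (a : G) (Q : {set G}) : a \notin Q -> [disjoint [set a] & Q] by rewrite disjoints1.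
  have D2 (Q : {set G}) : u \notin Q -> w \notin Q -> [disjoint [set u; w] & Q].
    move=> uQ wQ; rewrite disjoint_subset; apply/fintype.subsetP => c.
    by rewrite !inE => /orP[] /eqP->.
  case: i hi => [|[|[|[|[|//]]]]] _; case: j hj => [|[|[|[|[|//]]]]] _ //= _;
    first [apply: D2 | apply: D1]; rewrite ?finset.in_set1 // eq_sym //.
- move=> [i hi] [j hj]; rewrite /phi /=.
  case: i hi => [|[|[|[|[|//]]]]] _; case: j hj => [|[|[|[|[|//]]]]] _ //= _.
  + by exists w, v; rewrite !inE !eqxx orbT edge_sym.
  + by exists u, x; rewrite !inE !eqxx.
  + by exists u, y; rewrite !inE !eqxx.
  + by exists u, z; rewrite !inE !eqxx.
  + by exists v, x; rewrite !inE !eqxx.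
  + by exists v, y; rewrite !inE !eqxx.
  + by exists v, z; rewrite !inE !eqxx.
  + by exists x, y; rewrite !inE !eqxx.
  + by exists x, (last z p); rewrite inE eqxx edge_sym.
  + by exists y, z; rewrite inE eqxx.
Qed.

Lemma two_hubs_isomorphic : A != finset.set0 ->
  isomorphic G (join (edgeless 2) (cycle_graph (#|G| - 2))).
Proof.
move=> A0; have [s [us sA s3 cs]] := two_regular_cycle (@edge_sym G) (@edge_irr G) deg2 A0.
have As := cycle_covers us sA s3 cs.
have unuvs : uniq [:: u, v & s].
  rewrite /= inE negb_or uv us andbT /=.
  by apply/andP; split; apply/negP => /sA/uvA[]; rewrite ?eqxx.
have all_uvs c : c \in [:: u, v & s].
  rewrite !inE; case: eqVneq => //= cu; case: eqVneq => //= cv.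
  by apply/As/A_all.
have cG : #|G| = (size s).+2.
  rewrite -[RHS]/(size [:: u, v & s]) -(card_uniqP unuvs).
  by apply: eq_card => c; rewrite all_uvs.
have -> : (#|G| - 2 = size s)%N by rewrite cG !subSS subn0.
apply: isomorphic_sym.
pose c (i : 'I_(size s)) := nth u s i.
have cA i : c i \in A by apply/sA/mem_nth.
have cinj : injective c.
  by move=> i j /eqP; rewrite nth_uniq // => /eqP/val_inj.
pose g (a : join (edgeless 2) (cycle_graph (size s))) : G :=
  match a with inl i => if i == ord0 then u else v | inr i => c i end.
have ginj : injective g.
  move=> [i|i] [j|j] /=.
  - case: (eqVneq i ord0) => [->|i0]; case: (eqVneq j ord0) => [->|j0] //.
    + by move/eqP; rewrite (negPf uv).
    + by move/esym/eqP; rewrite (negPf uv).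
    + move=> _; congr inl; apply/val_inj => /=.
      by case: i j i0 j0 => [[|[|i]] hi] // [[|[|j]] hj].
  - by have [_ _] := uvA (cA j); case: ifP => _ + + E; rewrite E eqxx.
  - by have [_ _] := uvA (cA i); case: ifP => _ + + E; rewrite E eqxx.
  - by move=> /cinj->.
exists g.
  by apply: inj_card_bij => //; rewrite cG card_sum !card_ord.
move=> [i|i] [j|j] /=.
- by case: ifP => _; case: ifP => _; rewrite ?edge_irr // ?(edge_sym v) (negPf nuv).
- by have [uj vj _ _] := uvA (cA j); case: ifP.
- by have [ui vi _ _] := uvA (cA i); case: ifP; rewrite edge_sym.
have eS k : edge (c k) (c (ordS k)) by apply: cycle_nth.
have eP k : edge (c k) (c (ord_pred k)) by rewrite edge_sym -{2}[k]ord_predK.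
(* Equality would make the length of the cycle divide 2. *)
have SP : ordS i != ord_pred i.
  apply/eqP => /(congr1 (@ordS _)); rewrite ord_predK => /(congr1 val) /=.
  rewrite -addn1 modnDml addn1 => h.
  have : (i.+2 == i %[mod size s])%N by rewrite h modn_small.
  rewrite eqn_mod_dvd; last exact: leqW (leqnSn i).
  by rewrite -addn2 addKn => /dvdn_leq => /(_ isT); rewrite leqNgt s3.
(* The two cycle neighbours exhaust the degree 2, so the cycle has no chord. *)
have Ni : [set w in A | edge (c i) w] = [set c (ordS i); c (ord_pred i)].
  apply/esym/eqP; rewrite eqEcard; apply/andP; split.
    apply/fintype.subsetP => w; rewrite finset.in_set2 finset.in_set.
    by move=> /orP[] /eqP->; rewrite cA /=.
  by rewrite -/(deg_in edge A (c i)) (deg2 (cA i)) cards2 (inj_eq cinj) SP.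
have -> : edge (c i) (c j) = (c j \in [set w in A | edge (c i) w]).
  by rewrite [RHS]inE cA.
rewrite Ni !inE !(inj_eq cinj) /cycle_edge.
have -> : (j == ord_pred i) = (ordS j == i).
  by apply/eqP/eqP => [->|<-]; rewrite ?ord_predK ?ordSK.
rewrite [j == _]eq_sym; case: (eqVneq i j) => //= <-; rewrite orbb.
by apply/negbTE; apply: contraTN (eS i) => /eqP->; rewrite edge_irr.
Qed.

End Join.

(** * A plane drawing of 2K_1 + C_m *)

Section WheelDrawing.
Variable R : realType.
Local Open Scope classical_set_scope.

Lemma planar_isomorphic (G H : sgraph) : isomorphic G H -> planar R H -> planar R G.
Proof.
move=> [f [g fK gK] fe] [p [A [pinj arcA symA vA AA]]].
exists (p \o f), (fun x y => A (f x) (f y)); split.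
- by move=> x y /pinj/(can_inj fK).
- by move=> x y xy; apply: arcA; rewrite fe.
- by move=> x y xy; apply: symA; rewrite fe.
- move=> x y z xy /vA; rewrite fe => /(_ xy) [] /(can_inj fK) ->; [by left|by right].
- move=> x y u v xy uv n1 n2 q Aq.
  have [|||| w _ <-] := AA (f x) (f y) (f u) (f v) _ _ _ _ q Aq; rewrite ?fe //.
  + by move=> -[/(can_inj fK) xu /(can_inj fK) yv]; apply: n1; rewrite xu yv.
  + by move=> -[/(can_inj fK) xv /(can_inj fK) yu]; apply: n2; rewrite xv yu.
  + by exists (g w) => //=; rewrite gK.
Qed.

(** The product condition says that the abscissa lies between the ends in either order, which makes
    the set symmetric in [a] and [b]. *)
Definition graph_over (a b : R) (F : R -> R) : set (R * R) :=
  [set q | (q.1 - a) * (q.1 - b) <= 0 /\ q.2 = F q.1].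

Lemma graph_overC a b F : graph_over a b F = graph_over b a F.
Proof. by apply/seteqP; split=> q [h ?]; split; rewrite // mulrC. Qed.

Lemma graph_arc (a b : R) (F : R -> R) : a != b -> continuous F ->
  is_arc (a, F a) (b, F b) (graph_over a b F).
Proof.
move=> ab cF; have ba0 : b - a != 0 by rewrite subr_eq0 eq_sym.
pose h s := a + s * (b - a).
have ch : continuous h.
  by move=> s; apply: cvgD; [exact: cvg_cst | apply: cvgM; [exact: cvg_id|exact: cvg_cst]].
exists (fun s => (h s, F (h s))); split.
- apply: continuous_subspaceT => s.
  apply: (@cvg_pair _ _ _ _ (nbhs (h s)) (nbhs (F (h s)))); first exact: ch.
  by apply: continuous_comp; [exact: ch | exact: cF].
- by move=> s t _ _ [/addrI/(mulIf ba0)].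
- by rewrite /h mul0r addr0.
- by rewrite /h mul1r subrKC.
- apply/seteqP; split => [[q1 q2] [/= q1ab ->]|_ [s /= s01 <-]].
    exists ((q1 - a) / (b - a)); last by rewrite /h divfK // subrKC.
    rewrite /= in_itv /=.
    have e : (q1 - a) * (q1 - b) =
        (b - a) ^+ 2 * (((q1 - a) / (b - a)) * ((q1 - a) / (b - a) - 1)).
      by field.
    move: q1ab; rewrite e pmulr_rle0 ?exprn_even_gt0 //.
    set s := _ / _ => hs; apply/andP; split; nra.
  move: s01; rewrite in_itv /= => /andP[s0 s1]; split => //=.
  rewrite /h (_ : (a + s * (b - a) - a) * (a + s * (b - a) - b) = (b - a) ^+ 2 * (s * (s - 1))); last by ring.
  by rewrite mulr_ge0_le0 ?sqr_ge0 // mulr_ge0_le0 // subr_le0.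
Qed.

Lemma graph_arcs (a b : R) (F : R -> R) : a != b -> continuous F ->
  is_arc (a, F a) (b, F b) (graph_over a b F) /\
  is_arc (b, F b) (a, F a) (graph_over a b F).
Proof.
by move=> ab cF; split; [|rewrite graph_overC]; apply: graph_arc; rewrite // eq_sym.
Qed.

Lemma N1_neq (c : R) : 1 <= c -> -1 <> c.
Proof. by move=> c1 E; lra. Qed.

Section Wheel.
Variable m : nat.
Hypothesis m3 : (3 <= m)%N.

(* The rim vertices lie on the horizontal axis at 1, ..., m - 1 and -1, the hubs at
   (0, 1) and (0, -1); the rim edge from m - 1 to -1 is a parabola above the upper
   hub.  Every edge is a graph over an interval. *)
Definition rim_x (j : 'I_m) : R := if (j.+1 == m)%N then -1 else j.+1%:R.

Definition hub_y (i : 'I_2) : R := if i == ord0 then 1 else -1.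

Definition wheel_pt (z : 'I_2 + 'I_m) : R * R :=
  match z with inl i => (0, hub_y i) | inr j => (rim_x j, 0) end.

Definition spoke (i : 'I_2) (j : 'I_m) : set (R * R) :=
  graph_over 0 (rim_x j) (fun t => hub_y i * (1 - t / rim_x j)).

Definition outer (t : R) : R := (t + 1) * (m.-1%:R - t).

(** [k.+2 = m] is the edge from m - 1 to -1. The edge from -1 to 1 is flat and passes between the
    hubs. *)
Definition rim_fun (k : 'I_m) (t : R) : R :=
  if (k.+2 == m)%N then outer t else 0.

Definition rim_edge (k : 'I_m) : set (R * R) :=
  graph_over (rim_x k) (rim_x (ordS k)) (rim_fun k).

Definition wheel_arc (x y : 'I_2 + 'I_m) : set (R * R) :=
  match x, y with
  | inl i, inr j | inr j, inl i => spoke i j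
  | inr i, inr j => if ordS i == j then rim_edge i else rim_edge j
  | _, _ => set0
  end.

Variant rim_x_spec (j : 'I_m) : R -> Prop :=
| RimLast of j = m.-1 :> nat : rim_x_spec j (-1)
| RimInner of (j.+1 < m)%N & 1 <= j.+1%:R :> R & j.+1%:R <= m.-1%:R :> R :
    rim_x_spec j j.+1%:R.

Lemma rim_xP j : rim_x_spec j (rim_x j).
Proof.
rewrite /rim_x; case: eqP => [jm|/eqP jm]; first by apply: RimLast; have := congr1 predn jm.
have jm' : (j.+1 < m)%N by rewrite ltn_neqAle jm ltn_ord.
apply: RimInner => //; first by rewrite ler1n.
by rewrite ler_nat -ltnS prednK // (ltn_trans _ jm').
Qed.

Lemma m_ge2 : 2 <= m.-1%:R :> R.
Proof. by rewrite (ler_nat R 2) -ltnS prednK // (ltn_trans _ m3). Qed.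

Lemma rim_x_inj : injective rim_x.
Proof.
move=> i j; case: (rim_xP i) => [hi|hi i1 _]; case: (rim_xP j) => [hj|hj j1 _].
- by move=> _; apply/val_inj; rewrite /= hi hj.
- by move/(N1_neq j1).
- by move/esym/(N1_neq i1).
- by move=> /eqP; rewrite eqr_nat => /eqP[/val_inj].
Qed.

Lemma rim_x_neq0 j : rim_x j != 0.
Proof. case: (rim_xP j) => [_|_ j1 _]; first by rewrite oppr_eq0 oner_eq0.
by rewrite pnatr_eq0. Qed.

Lemma hub_yP i : hub_y i = 1 \/ hub_y i = -1.
Proof. by rewrite /hub_y; case: ifP; [left|right]. Qed.

Lemma hub_y_neq0 i : hub_y i != 0.
Proof. by case: (hub_yP i) => ->; apply/eqP; lra. Qed.

Lemma hub_y_neq i i' : i != i' -> hub_y i = - hub_y i'.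
Proof.
rewrite /hub_y; case: i i' => [[|[|//]] ?] [[|[|//]] ?] //= _.
by rewrite opprK.
Qed.

Lemma wheel_pt_inj : injective wheel_pt.
Proof.
move=> [i|i] [j|j] //=.
- move=> [E]; congr inl; apply/eqP; apply: contraT => /hub_y_neq.
  by have := hub_y_neq0 i; rewrite E => /eqP *; lra.
- by case=> _ /eqP; rewrite (negPf (hub_y_neq0 i)).
- by case=> _ /esym/eqP; rewrite (negPf (hub_y_neq0 j)).
- by case=> /rim_x_inj->.
Qed.

Lemma spoke_factor j t : (t - 0) * (t - rim_x j) <= 0 -> 0 <= 1 - t / rim_x j.
Proof.
rewrite subr0 => h; have a0 := rim_x_neq0 j.
have e : t * (t - rim_x j) = rim_x j ^+ 2 * ((t / rim_x j) * (t / rim_x j - 1)) by field.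
move: h; rewrite e pmulr_rle0 ?exprn_even_gt0 //; set s := _ / _ => hs; nra.
Qed.

Lemma spoke_axis i j t : hub_y i * (1 - t / rim_x j) = 0 -> t = rim_x j.
Proof.
move/eqP; rewrite mulf_eq0 (negPf (hub_y_neq0 i)) /= subr_eq0 => /eqP/esym E.
by rewrite -[LHS](divfK (rim_x_neq0 j)) E mul1r.
Qed.

Lemma outer_ge0 t : -1 <= t -> t <= m.-1%:R -> 0 <= outer t.
Proof. by move=> *; rewrite mulr_ge0 //; lra. Qed.

Lemma ordS_val (k : 'I_m) : val (ordS k) = if (k.+1 == m)%N then 0%N else k.+1.
Proof.
rewrite /=; case: eqP => [->|/eqP km]; first by rewrite modnn.
by rewrite modn_small // ltn_neqAle km ltn_ord.
Qed.

Variant rim_edge_spec (k : 'I_m) : set (R * R) -> Prop :=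
| RimFlat of (k.+2 < m)%N : rim_edge_spec k
    [set q | k.+1%:R <= q.1 <= k.+2%:R /\ q.2 = 0]
| RimOuter of k.+2 = m : rim_edge_spec k
    [set q | -1 <= q.1 <= m.-1%:R /\ q.2 = outer q.1]
| RimLeft of k.+1 = m : rim_edge_spec k
    [set q | -1 <= q.1 <= 1 /\ q.2 = 0].

Lemma between_le (a b t : R) : a <= b -> (t - a) * (t - b) <= 0 <-> a <= t <= b.
Proof.
by move=> ab; split=> [h|/andP[h1 h2]]; [apply/andP; split; nra | nra].
Qed.

Lemma rim_edgeP k : rim_edge_spec k (rim_edge k).
Proof.
rewrite /rim_edge /rim_fun.
have [k1|k1] := eqVneq k.+1 m.
  rewrite (_ : rim_x k = -1); last by rewrite /rim_x k1 eqxx.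
  rewrite (_ : rim_x (ordS k) = 1); last first.
    by rewrite /rim_x ordS_val k1 eqxx; case: eqP => // m1; exfalso; move: m3; lia.
  rewrite (_ : (k.+2 == m)%N = false); last by apply/eqP; lia.
  have -> : graph_over (-1) 1 (fun=> 0) = [set q | -1 <= q.1 <= 1 /\ q.2 = 0] :> set (R * R).
    by apply/seteqP; split => q [h E]; split => //; apply/between_le => //; lra.
  exact: RimLeft.
have k1m : (k.+1 < m)%N by rewrite ltn_neqAle k1 ltn_ord.
have Sk : val (ordS k) = k.+1 by rewrite ordS_val (negPf k1).
rewrite {1}/rim_x (negPf k1) {1}/rim_x Sk.
have [k2|k2] := eqVneq k.+2 m.
  have -> : k.+1 = m.-1 by lia.
  rewrite graph_overC.
  have -> : graph_over (-1) m.-1%:R outer = [set q | -1 <= q.1 <= m.-1%:R /\ q.2 = outer q.1].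
    have := m_ge2; move: (m.-1%:R) => M M2.
    by apply/seteqP; split => q [h E]; split => //; apply/between_le => //; lra.
  exact: RimOuter.
have -> : graph_over k.+1%:R k.+2%:R (fun=> 0) =
    [set q | k.+1%:R <= q.1 <= k.+2%:R /\ q.2 = 0] :> set (R * R).
  apply/seteqP; split => q [h E]; split => //; apply/between_le => //; by rewrite ler_nat.
by apply: RimFlat; rewrite ltn_neqAle k2.
Qed.

Lemma outer_eq0 t : outer t = 0 -> t = -1 \/ t = m.-1%:R.
Proof.
move/eqP; rewrite mulf_eq0 subr_eq0 addr_eq0 => /orP[/eqP->|/eqP->]; by [left|right].
Qed.

Lemma spoke_vertex i j z : spoke i j (wheel_pt z) -> z = inl i \/ z = inr j.
Proof.
case: z => [i'|j'] [_ /=].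
  rewrite mul0r subr0 mulr1 => E; left; congr inl; apply/eqP; apply: contraT => /hub_y_neq.
  by have /eqP := hub_y_neq0 i; rewrite E => *; lra.
by move=> /esym/spoke_axis/rim_x_inj->; right.
Qed.

Lemma rim_vertex k z : rim_edge k (wheel_pt z) -> z = inr k \/ z = inr (ordS k).
Proof.
have last j k' : k'.+1 = m -> j = m.-1 :> nat -> j = k' :> nat by move=> <-.
case: (rim_edgeP k) => h; case: z => [i|j] [/= h1 h2].
- by have := hub_y_neq0 i; rewrite h2 eqxx.
- have Sk : val (ordS k) = k.+1 by rewrite ordS_val ltn_eqF // ltnW.
  move: h1; case: (rim_xP j) => [_ /andP[h' _]|_ _ _].
    by exfalso; have := ler0n R k.+1; lra.
  rewrite !ler_nat !ltnS => /andP[kj]; rewrite leq_eqVlt ltnS => /orP[/eqP jk|jk].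
    by right; congr inr; apply/val_inj; rewrite Sk.
  by left; congr inr; apply/val_inj/eqP; rewrite eqn_leq jk kj.
- by exfalso; have := m_ge2; move: h2; rewrite /outer; case: (hub_yP i) => ->; lra.
- have Sk : val (ordS k) = k.+1 by rewrite ordS_val ltn_eqF //; lia.
  move: h2 => /esym/outer_eq0; case: (rim_xP j) => [jm _|_ j1 _ [jm|/eqP]].
  + by right; congr inr; apply/val_inj; rewrite Sk /=; lia.
  + by case: (N1_neq j1).
  + by rewrite eqr_nat => /eqP jm; left; congr inr; apply/val_inj => /=; lia.
- by have := hub_y_neq0 i; rewrite h2 eqxx.
- have Sk : val (ordS k) = 0%N by rewrite ordS_val h eqxx.
  move: h1; case: (rim_xP j) => [jm _|_ _ _ /andP[_]].
    by left; congr inr; apply/val_inj => /=; lia.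
  rewrite (ler_nat R _ 1) ltnS leqn0 => /eqP j0.
  by right; congr inr; apply/val_inj; rewrite Sk.
Qed.

Lemma rim_pt_range j t : t = rim_x j -> range wheel_pt (t, 0 : R).
Proof. by move=> ->; exists (inr j). Qed.

(** Spokes of different hubs lie on opposite sides of the axis and can only meet on it; two spokes
    of one hub are segments of different slopes. *)
Lemma spoke_spoke i j i' j' : (i, j) <> (i', j') ->
  spoke i j `&` spoke i' j' `<=` range wheel_pt.
Proof.
move=> ne [t y] [[/= h1 h2] [/= h3 h4]].
have s1 := spoke_factor h1; have s2 := spoke_factor h3.
have [ii|/hub_y_neq E] := eqVneq i i'.
  move: h4; rewrite h2 ii => /(mulfI (hub_y_neq0 i')) /addrI/oppr_inj E.
  have [t0|t0] := eqVneq t 0.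
    by exists (inl i') => //=; rewrite t0 mul0r subr0 mulr1.
  move: E => /(mulfI t0)/invr_inj/rim_x_inj jj.
  by case: ne; rewrite ii jj.
have e0 : hub_y i * (1 - t / rim_x j) = 0.
  move: h4; rewrite h2 E; case: (hub_yP i') => ->; move: (_ / _) (_ / _) s1 s2 => *; lra.
by rewrite h2 e0; apply: rim_pt_range (spoke_axis e0).
Qed.

Lemma spoke_rim i j k : spoke i j `&` rim_edge k `<=` range wheel_pt.
Proof.
move=> [t y] [[/= h1 h2]]; have s1 := spoke_factor h1; rewrite {}h2.
have axis : hub_y i * (1 - t / rim_x j) = 0 ->
    range wheel_pt (t, hub_y i * (1 - t / rim_x j)).
  by move=> e0; rewrite e0; apply: rim_pt_range (spoke_axis e0).
case: (rim_edgeP k) => h [/= h3 h4]; try exact: axis.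
apply: axis; rewrite h4; move: h3 => /andP[t1 tm].
have o0 := outer_ge0 t1 tm.
case: (hub_yP i) h4 => -> h4; last by move: (_ / _) s1 h4 => s *; lra.
have M2 := m_ge2.
case: (rim_xP j) h1 h4 s1 => [_|_ j1 jM]; rewrite subr0.
  (* The spoke to -1 is the graph of 1 + t, which meets the parabola only where t + 1 = 0 or t = m -
     2 > 0. *)
  rewrite invrN1 mulrN1 mul1r !opprK /outer => h1 h4 _.
  have tle0 : t <= 0 by nra.
  have : (t + 1) * (m.-1%:R - t - 1) = 0 by rewrite mulrBr mulr1 -h4; ring.
  by move/eqP; rewrite mulf_eq0 => /orP[/eqP->|/eqP]; [rewrite mul0r | lra].
rewrite /outer; move: (j.+1%:R) (m.-1%:R) j1 jM M2 tm => c M c1 cM M2 tm h1 h4 s1.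
have c0 : 0 < c by lra.
have [t0 tc] : 0 <= t /\ t <= c by split; nra.
(* At a meeting point M(1 - t/c) <= M - t <= (t + 1)(M - t) = 1 - t/c; as M >= 2, the common height
   is 0. *)
have : M - t <= 1 - t / c.
  by rewrite -[leRHS]mul1r h4 -subr_ge0 (_ : _ - _ = t * (M - t)) ?mulr_ge0 ?subr_ge0 //; ring.
have : M * (1 - t / c) <= M - t.
  rewrite -subr_ge0 (_ : _ - _ = (M - c) * (t / c)).
    by rewrite mulr_ge0 ?subr_ge0 // divr_ge0 // ltW.
  by field; rewrite gt_eqF.
have := ler_wpM2r s1 M2; rewrite -h4; move: (t / c) s1 => s *; lra.
Qed.

Lemma rim_x_inner (j : 'I_m) : (j.+1 < m)%N -> rim_x j = j.+1%:R.
Proof. by move=> jm; rewrite /rim_x ltn_eqF. Qed.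

Lemma rim_x_last (j : 'I_m) : j.+1 = m -> rim_x j = -1.
Proof. by move=> jm; rewrite /rim_x jm eqxx. Qed.

Lemma rim_rim_lt (k k' : 'I_m) : (k < k')%N -> rim_edge k `&` rim_edge k' `<=` range wheel_pt.
Proof.
have k'm := ltn_ord k'; have M2 := m_ge2.
case: (rim_edgeP k) => h; case: (rim_edgeP k') => h' kk' [t y] [[/= /andP[t1 t2] ->] [/= /andP[t3 t4] e]];
  try by exfalso; lia.
- apply: (@rim_pt_range k'); rewrite rim_x_inner; last by lia.
  have : k.+2%:R <= k'.+1%:R :> R by rewrite ler_nat.
  lra.
- move: e => /esym/outer_eq0[->|->].
    have m0 : (m.-1 < m)%N by lia.
    by apply: (@rim_pt_range (Ordinal m0)); rewrite rim_x_last //=; lia.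
  apply: (@rim_pt_range k'); rewrite rim_x_inner; last by lia.
  by congr (_%:R); lia.
- apply: (@rim_pt_range k); rewrite rim_x_inner; last by lia.
  have : 1 <= k.+1%:R :> R by rewrite ler1n.
  lra.
- rewrite e; move: e => /outer_eq0[->|tM]; last by exfalso; lra.
  by apply: (@rim_pt_range k'); rewrite rim_x_last.
Qed.

Lemma rim_rim k k' : k != k' -> rim_edge k `&` rim_edge k' `<=` range wheel_pt.
Proof.
by rewrite -val_eqE neq_ltn => /orP[/rim_rim_lt//|/rim_rim_lt]; rewrite setIC.
Qed.

Lemma ordS_neq (k : 'I_m) : ordS k != k.
Proof.
apply/eqP => /(congr1 val); rewrite ordS_val; have km := ltn_ord k.
by case: eqP => ? /= ?; lia.
Qed.

(** Makes the choice in [wheel_arc] independent of the order of the two ends. *)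
Lemma ordSS_neq (k : 'I_m) : ordS (ordS k) != k.
Proof.
apply/eqP => /(congr1 val); rewrite ordS_val -[nat_of_ord (ordS k)]/(val (ordS k)).
have km := ltn_ord k; rewrite ordS_val /=.
by case: (eqVneq k.+1 m) => ?; case: eqVneq => ? /= ?; lia.
Qed.

Let H := join (edgeless 2) (cycle_graph m).

Variant edge_code (x y : H) : set (R * R) -> Prop :=
| Spoke i j of (x, y) = (inl i, inr j) \/ (y, x) = (inl i, inr j) :
    edge_code x y (spoke i j)
| Rim k of (x, y) = (inr k, inr (ordS k)) \/ (y, x) = (inr k, inr (ordS k)) :
    edge_code x y (rim_edge k).

Lemma edge_codeP (x y : H) : edge x y -> edge_code x y (wheel_arc x y).
Proof.
case: x y => [i|i] [j|j] //=.
- by move=> _; apply: Spoke; left.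
- by move=> _; apply: Spoke; right.
case/andP => _ /orP[/eqP<-|/eqP<-]; first by rewrite eqxx; apply: Rim; left.
by rewrite (negPf (ordSS_neq _)); apply: Rim; right.
Qed.

Lemma wheel_arcC (x y : H) : edge x y -> wheel_arc x y = wheel_arc y x.
Proof.
case: x y => [i|i] [j|j] //= /andP[_ /orP[/eqP<-|/eqP<-]];
  by rewrite eqxx (negPf (ordSS_neq _)).
Qed.

Lemma rim_fun_end k : rim_fun k (rim_x k) = 0 /\ rim_fun k (rim_x (ordS k)) = 0.
Proof.
rewrite /rim_fun; case: eqP => // km; rewrite /outer rim_x_inner; last by lia.
rewrite rim_x_last; last by rewrite ordS_val; case: eqP; lia.
have -> : k.+1 = m.-1 by lia.
by rewrite addNr mul0r subrr mulr0.
Qed.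

Lemma spoke_arc i j :
  is_arc (wheel_pt (inl i)) (wheel_pt (inr j)) (spoke i j) /\
  is_arc (wheel_pt (inr j)) (wheel_pt (inl i)) (spoke i j).
Proof.
have cF : continuous (fun t : R => hub_y i * (1 - t / rim_x j)).
  move=> t; apply: cvgM; first exact: cvg_cst.
  by apply: cvgB; [exact: cvg_cst|apply: cvgM; [exact: cvg_id|exact: cvg_cst]].
have a0 : 0 != rim_x j by rewrite eq_sym rim_x_neq0.
by have := graph_arcs a0 cF; rewrite mul0r subr0 mulr1 divff ?rim_x_neq0 // subrr mulr0.
Qed.

Lemma rim_arc k :
  is_arc (wheel_pt (inr k)) (wheel_pt (inr (ordS k))) (rim_edge k) /\
  is_arc (wheel_pt (inr (ordS k))) (wheel_pt (inr k)) (rim_edge k).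
Proof.
have cF : continuous (rim_fun k).
  rewrite /rim_fun; case: eqP => _ t; last exact: cvg_cst.
  apply: cvgM; first by apply: cvgD; [exact: cvg_id|exact: cvg_cst].
  by apply: cvgB; [exact: cvg_cst|exact: cvg_id].
have a0 : rim_x k != rim_x (ordS k) by rewrite (inj_eq rim_x_inj) eq_sym ordS_neq.
by have := graph_arcs a0 cF; have [-> ->] := rim_fun_end k.
Qed.

Lemma join_cycle_planar : planar R H.
Proof.
exists wheel_pt, wheel_arc; split.
- exact: wheel_pt_inj.
- move=> x y /edge_codeP[i j [[-> ->]|[-> ->]]|k [[-> ->]|[-> ->]]].
  + by case: (spoke_arc i j).
  + by case: (spoke_arc i j).
  + by case: (rim_arc k).
  + by case: (rim_arc k).
- exact: wheel_arcC.
- move=> x y z /edge_codeP[i j|k] [] [-> ->].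
  + by move=> /spoke_vertex.
  + by move=> /spoke_vertex[]; [right|left].
  + by move=> /rim_vertex.
  + by move=> /rim_vertex[]; [right|left].
- move=> x y x' y' /edge_codeP xy /edge_codeP xy' n1 n2.
  case: xy xy' n1 n2 => [i j|k] E1 [i' j'|k'] E2 n1 n2.
  + apply: spoke_spoke => -[ii jj]; rewrite {}ii {}jj in E1.
    by case: E1 E2 n1 n2 => -[-> ->] [] [-> ->].
  + exact: spoke_rim.
  + by rewrite setIC; exact: spoke_rim.
  + apply: rim_rim; apply/eqP => kk; rewrite {}kk in E1.
    by case: E1 E2 n1 n2 => -[-> ->] [] [-> ->].
Qed.

End Wheel.

End WheelDrawing.

(** * Spectral radii *)

Section SpectralRadius.
Variables (R : realType) (G : sgraph).

Lemma eigenvalue_subinvariant (a : R) : eigenvalue (adjmx R G) a ->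
  exists z : G -> R, [/\ forall v, 0 <= z v, exists v, 0 < z v
    & forall v, `|a| * z v <= \sum_(w | edge v w) z w].
Proof.
case/eigenvalueP => y ya y0; exists (fun v => `|y ord0 (enum_rank v)|); split.
- by move=> v; exact: normr_ge0.
- have [j yj] : exists j, y ord0 j != 0.
    apply/existsP; apply: contraNT y0; rewrite negb_exists => /forallP h.
    by apply/eqP/rowP => j; rewrite mxE; apply/eqP; move: (h j); rewrite negbK.
  by exists (enum_val j); rewrite enum_valK normr_gt0.
- move=> v; rewrite -normrM.
  have -> : a * y ord0 (enum_rank v) = \sum_(w | edge v w) y ord0 (enum_rank w).
    have := congr1 (fun M : 'rV_#|G| => M ord0 (enum_rank v)) ya; rewrite !mxE => <-.
    rewrite (reindex enum_rank) /=; last exact/onW_bij/enum_rank_bij.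
    rewrite [RHS]big_mkcond /=; apply: eq_bigr => w _.
    by rewrite mxE !enum_rankK edge_sym; case: (edge v w); rewrite ?mulr1 ?mulr0.
  exact: ler_norm_sum.
Qed.

(* The eigenvalues are finitely many, so their supremum is attained. *)
Lemma spectral_radius_attained (rho : R) : 0 < rho -> rho <= spectral_radius R G ->
  exists2 a, eigenvalue (adjmx R G) a & rho <= a.
Proof.
move=> rho0 rhoG; apply: contrapT => none.
have small a : eigenvalue (adjmx R G) a -> a < rho.
  by move=> ea; rewrite ltNge; apply/negP => ra; apply: none; exists a.
have larger a : eigenvalue (adjmx R G) a -> exists2 b, eigenvalue (adjmx R G) b & a < b.
  move=> ea; apply: contrapT => nb; suff : spectral_radius R G <= a.
    by move=> h; have := small a ea; rewrite ltNge (le_trans rhoG).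
  apply: ge_sup; first by exists a.
  by move=> b /= eb; rewrite leNgt; apply/negP => ab; apply: nb; exists b.
(* Without eigenvalues the supremum would be the default value 0, below [rho]. *)
have [a0 ea0] : exists a, eigenvalue (adjmx R G) a.
  apply: contrapT => ne; move: rhoG; rewrite /spectral_radius.
  rewrite (_ : [set a | _]%classic = classical_sets.set0) ?sup0 1?leNgt ?rho0 //.
  by apply/seteqP; split => // a /= ea; apply: ne; exists a.
(* Without a largest eigenvalue the characteristic polynomial would have arbitrarily many distinct
   roots. *)
have chain k : exists a s, [/\ eigenvalue (adjmx R G) a, uniq s, size s = k,
    all (eigenvalue (adjmx R G)) s & all (fun b => b < a) s].
  elim: k => [|k [a [s [ea us <- es ls]]]]; first by exists a0, [::].
  have [b eb ab] := larger a ea; exists b, (a :: s); split=> //=.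
  - by rewrite us andbT; apply/negP => /(allP ls); rewrite ltxx.
  - by rewrite ea.
  - by rewrite ab /=; apply/allP => c /(allP ls) ca; exact: lt_trans ab.
have [a [s [_ us sz es _]]] := chain (size (char_poly (adjmx R G))).
have p0 : char_poly (adjmx R G) != 0 by exact/monic_neq0/char_poly_monic.
have rs : all (root (char_poly (adjmx R G))) s.
  by apply/allP => b /(allP es); rewrite eigenvalue_root_char.
by have := max_poly_roots p0 rs us; rewrite sz ltnn.
Qed.

Lemma spectral_radius_subinvariant (rho : R) : 0 < rho -> rho <= spectral_radius R G ->
  exists x : G -> R, [/\ forall v, 0 <= x v, forall v, x v <= 1, exists v, x v = 1
    & forall v, rho * x v <= \sum_(w | edge v w) x w].
Proof.
move=> rho0 /(spectral_radius_attained rho0)[a ea ra].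
have [z [z0 [v zv] za]] := eigenvalue_subinvariant ea.
have [u _ umax] : exists2 u, true & forall w, z w <= z u.
  by case: (@arg_maxP _ _ _ v predT z isT) => u _ h; exists u => // w; exact: h.
have zu : 0 < z u := lt_le_trans zv (umax v).
exists (fun w => z w / z u); split.
- by move=> w; rewrite divr_ge0 // ltW.
- by move=> w; rewrite ler_pdivrMr // mul1r.
- by exists u; rewrite divff // gt_eqF.
- move=> w; rewrite -mulr_suml mulrA ler_wpM2r ?invr_ge0 ?(ltW zu) //.
  apply: le_trans (za w); rewrite ler_wpM2r //.
  exact: le_trans ra (ler_norm a).
Qed.

(** At a vertex [u] maximising z / y, where z is the absolute value of an eigenvector for a, |a|
    z(u) is at most z(u)/y(u) times the sum of y over the neighbours of [u], that is [rho] z(u). *)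
Lemma spectral_radius_positive (rho : R) (y : G -> R) : (0 < #|G|)%N -> 0 <= rho ->
  (forall v, 0 < y v) -> (forall v, \sum_(w | edge v w) y w = rho * y v) ->
  spectral_radius R G = rho.
Proof.
move=> /card_gt0P[v0 _] rho0 y0 yE.
have ub a : eigenvalue (adjmx R G) a -> a <= rho.
  move=> /eigenvalue_subinvariant[z [z0 [v zv] za]].
  have [u _ umax] : exists2 u, true & forall w, z w / y w <= z u / y u.
    by case: (@arg_maxP _ _ _ v predT (fun w => z w / y w) isT) => u _ h; exists u => // w; exact: h.
  have t0 : 0 < z u / y u by apply: lt_le_trans (umax v); rewrite divr_gt0.
  have zu : 0 < z u by rewrite -(divfK (negbT (gt_eqF (y0 u))) (z u)) mulr_gt0.
  apply: le_trans (ler_norm a) _; rewrite -(ler_pM2r zu); apply: le_trans (za u) _.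
  have -> : rho * z u = (z u / y u) * \sum_(w | edge u w) y w.
    by rewrite yE; field; rewrite gt_eqF.
  by rewrite mulr_sumr; apply: ler_sum => w _; rewrite -ler_pdivrMr.
have erho : eigenvalue (adjmx R G) rho.
  apply/eigenvalueP; exists (\row_j y (enum_val j)).
    apply/rowP => j; rewrite !mxE -yE (reindex enum_rank) /=; last exact/onW_bij/enum_rank_bij.
    rewrite [RHS]big_mkcond /=; apply: eq_bigr => w _.
    by rewrite !mxE !enum_rankK edge_sym; case: (edge _ w); rewrite ?mulr1 ?mulr0.
  apply/eqP => /rowP/(_ (enum_rank v0)); rewrite !mxE => /eqP.
  by rewrite gt_eqF.
apply/eqP; rewrite eq_le; apply/andP; split.
  by apply: ge_sup; [exists rho|move=> a; exact: ub].
by apply: ub_le_sup => //; exists rho => a; exact: ub.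
Qed.

End SpectralRadius.

(** * Eigenvector and freeness of 2K_1 + C_m *)

Section JoinCycle.
Variables (R : realType) (m : nat).
Hypothesis m4 : (4 <= m)%N.
Let H := join (edgeless 2) (cycle_graph m).

Lemma cycle_nbrs (j : 'I_m) : [set k | cycle_edge j k] = [set ordS j; ord_pred j].
Proof.
apply/finset.setP => k; rewrite !inE /cycle_edge.
have -> : (ordS k == j) = (k == ord_pred j).
  by apply/eqP/eqP => [<-|->]; rewrite ?ordSK ?ord_predK.
rewrite [ordS j == k]eq_sym; case: (eqVneq j k) => //= <-.
have Sj : ordS j != j by apply: ordS_neq; exact: ltnW.
rewrite eq_sym (negPf Sj) /=; apply/esym/negbTE.
by apply: contraNneq Sj => E; rewrite [X in ordS X]E ord_predK.
Qed.

Lemma card_cycle_nbrs (j : 'I_m) : #|[set k | cycle_edge j k]| = 2%N.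
Proof.
rewrite cycle_nbrs cards2; suff -> : ordS j != ord_pred j by [].
by apply/eqP => /(congr1 (@ordS _)); rewrite ord_predK; apply/eqP/ordSS_neq/ltnW.
Qed.

(** Constant on hubs and on the rim: the rim equation is 2(rho - 2) + 4 = 2 rho, the hub equation 2m
    = rho(rho - 2). *)
Definition join_vec (rho : R) (x : H) : R := if x is inl _ then rho - 2 else 2.

Lemma join_vec_eigen (rho : R) (x : H) : rho ^+ 2 - 2 * rho = 2 * m%:R ->
  \sum_(y | edge x y) join_vec rho y = rho * join_vec rho x.
Proof.
move=> rhoE; rewrite big_mkcond big_sumType /=; case: x => [i|j] /=.
  rewrite big1 // add0r sumr_const card_ord -[2 *+ m]mulr_natr -rhoE; ring.
rewrite sumr_const card_ord -big_mkcond /=.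
rewrite (eq_bigl (fun k => k \in [set k | cycle_edge j k])) => [|k]; last by rewrite inE.
by rewrite sumr_const card_cycle_nbrs !mulr2n; ring.
Qed.

Lemma cycle_triangle_free (i j k : 'I_m) :
  ~~ [&& cycle_edge i j, cycle_edge j k & cycle_edge i k].
Proof.
have i4 := ltn_ord i; have j4 := ltn_ord j; have k4 := ltn_ord k.
have Si := ordS_val i; have Sj := ordS_val j.
have Sk := ordS_val k.
rewrite /cycle_edge -!val_eqE Si Sj Sk /=; apply/negP.
move: (i : nat) (j : nat) (k : nat) i4 j4 k4 => {i j k Si Sj Sk} i j k i4 j4 k4.
by case: (eqVneq i.+1 m) => ?; case: (eqVneq j.+1 m) => ?; case: (eqVneq k.+1 m) => ?; lia.
Qed.

(** The vertices 0, 2, 3, 4 span a K_4. At most one of them can be a hub, and three others would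
    form a triangle in C_m with m >= 4. *)
Lemma join_free : Defs.free K5_minus_e H.
Proof.
case=> f finj fe.
have nat_edge (i j : 'I_5) : i != j -> ~~ ((i < 2)%N && (j < 2)%N) -> edge (f i) (f j).
  by move=> ij h; apply: fe; rewrite /= /K5_minus_e_edge ij.
pose v k (h : (k < 5)%N) : H := f (Ordinal h).
pose a := v 0%N isT; pose b := v 2%N isT; pose c := v 3%N isT; pose d := v 4%N isT.
have [ab ac ad] : [/\ edge a b, edge a c & edge a d] by split; apply: nat_edge.
have [bc bd cd] : [/\ edge b c, edge b d & edge c d] by split; apply: nat_edge.
move: ab ac ad bc bd cd; case: a => a; case: b => b; case: c => c; case: d => d //= ab ac ad bc bd cd.
- by have := cycle_triangle_free b c d; rewrite bc cd bd.
- by have := cycle_triangle_free a c d; rewrite ac cd ad.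
- by have := cycle_triangle_free a b d; rewrite ab bd ad.
- by have := cycle_triangle_free a b c; rewrite ab bc ac.
- by have := cycle_triangle_free a b c; rewrite ab bc ac.
Qed.

End JoinCycle.

Lemma free_isomorphic (F G H : sgraph) : isomorphic G H -> Defs.free F H -> Defs.free F G.
Proof.
move=> [f [g fK _] fe] freeH [h hinj he]; apply: freeH; exists (f \o h).
  exact: inj_comp (can_inj fK) hinj.
by move=> x y xy; rewrite /= fe; exact: he.
Qed.

Lemma sum_nbr_isomorphic (R : realType) (G H : sgraph) (f : G -> H) (y : H -> R) x :
  bijective f -> {mono f : x y / edge x y} ->
  \sum_(w | edge x w) y (f w) = \sum_(w | edge (f x) w) y w.
Proof.
move=> bf fe; rewrite [RHS](reindex f) /=; last exact: onW_bij.
by apply: eq_bigl => w; rewrite fe.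
Qed.

(** * Comparison with the extremal radius *)

Section Main.
Variable R : realType.

Definition wheel_radius (n : nat) : R := 1 + Num.sqrt (2 * n%:R - 3).

Lemma wheel_radiusE n : (2 <= n)%N ->
  wheel_radius n ^+ 2 - 2 * wheel_radius n = 2 * n%:R - 4.
Proof.
move=> n2; have h : 0 <= 2 * n%:R - 3 :> R.
  have : 2 <= n%:R :> R by rewrite (ler_nat R 2).
  by lra.
rewrite /wheel_radius -[in RHS](_ : Num.sqrt (2 * n%:R - 3) ^+ 2 + 3 = 2 * n%:R).
  by ring.
by rewrite sqr_sqrtr //; ring.
Qed.

Lemma wheel_radius_large (c : R) : exists N, forall n, (N <= n)%N -> c <= wheel_radius n.
Proof.
exists (Num.bound (c ^+ 2)).+3 => n nN; rewrite /wheel_radius.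
have cn : c ^+ 2 <= 2 * n%:R - 3.
  have h1 := archi_boundP (sqr_ge0 c).
  have : (Num.bound (c ^+ 2)).+3%:R <= n%:R :> R by rewrite ler_nat.
  by rewrite -addn3 natrD; move: h1; have := ler0n R (Num.bound (c ^+ 2)); lra.
have : Num.sqrt (c ^+ 2) <= Num.sqrt (2 * n%:R - 3) by rewrite ler_wsqrtr.
rewrite sqrtr_sqr => h; apply: le_trans (ler_norm c) _; apply: le_trans h _.
by rewrite lerDr.
Qed.

Lemma spectral_radius_wheel n (G : sgraph) : (6 <= n)%N ->
  isomorphic G (join (edgeless 2) (cycle_graph (n - 2))) ->
  spectral_radius R G = wheel_radius n.
Proof.
move=> n6 [f bf fe].
have rE := @wheel_radiusE n (leq_trans (isT : 2 <= 6)%N n6).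
(* This makes the hub weight [rho - 2] of [join_vec] positive. *)
have r2 : 2 < wheel_radius n.
  have s1 : Num.sqrt (1 : R) < Num.sqrt (2 * n%:R - 3).
    have : 6 <= n%:R :> R by rewrite (ler_nat R 6).
    by move=> h; rewrite ltr_sqrt; lra.
  by move: s1; rewrite /wheel_radius sqrtr1; lra.
have m4 : (4 <= n - 2)%N by lia.
apply: (@spectral_radius_positive _ _ _ (fun v => join_vec (wheel_radius n) (f v))).
- apply/card_gt0P; case: bf => g fK gK; by exists (g (inl ord0)).
- by apply: ltW; lra.
- by move=> v; rewrite /join_vec; case: (f v) => _; lra.
- move=> v; rewrite (sum_nbr_isomorphic _ _ bf fe) join_vec_eigen // rE natrB; last by lia.
  by ring.
Qed.

Lemma pos_of_almost_all (c n : R) : 3 <= n -> n - c <= 200^-1 * n -> 0 < c.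
Proof. by move=> *; lra. Qed.

Lemma wheel_of_large_radius : exists N, forall n, (N <= n)%N -> forall G : sgraph,
  planar_free R n K5_minus_e G -> wheel_radius n <= spectral_radius R G ->
  isomorphic G (join (edgeless 2) (cycle_graph (n - 2))).
Proof.
have [eps eps0 eps32] : exists2 eps : R, 0 < eps & 32 * eps = 400^-1.
  by exists (32^-1 * 400^-1); [rewrite mulr_gt0 // invr_gt0 ltr0n | rewrite mulVKf ?pnatr_eq0].
(* The first summand yields 528 <= [eps ^+ 2 * rho] for [two_step_small], the second 100 <= [rho]
   for [hubsP]. *)
have [N hN] := wheel_radius_large (528 / eps ^+ 2 + 100).
exists (N + 3)%N => n nN G [cG planarG freeG] rG.
have n3 : 3 <= #|G|%:R :> R.
  by rewrite (ler_nat R 3) cG (leq_trans (leq_addl N 3)).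
set rho := wheel_radius n in rG.
have e2 : 0 <= 528 / eps ^+ 2 by apply: divr_ge0; [exact: ler0n|exact: sqr_ge0].
have hr : 528 / eps ^+ 2 + 100 <= rho by apply: hN; lia.
have rho100 : 100 <= rho by lra.
have rho0 : 0 < rho by lra.
have big : 528 <= eps ^+ 2 * rho.
  have : 528 / eps ^+ 2 <= rho by lra.
  by rewrite ler_pdivrMr ?exprn_gt0 // mulrC.
have rhoE : rho ^+ 2 - 2 * rho = 2 * #|G|%:R - 4.
  by rewrite cG; apply: wheel_radiusE; lia.
have [x [x0 x1 [u xu] rx]] := spectral_radius_subinvariant rho0 rG.
have rho2 : 2 * #|G|%:R <= rho ^+ 2 by lra.
have eps64 : 64 * eps = 200^-1 by lra.
have eps1 : 32 * eps < 1 by rewrite eps32; lra.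
have [v [vu xv common]] := hubs planarG x0 x1 rx eps0 rho0 big eps1 rho2 xu.
rewrite eps32 in xv; rewrite eps64 in common.
have hubsP : [/\ x u = 1, 1 - 400^-1 <= x v, 100 <= rho,
  rho ^+ 2 - 2 * rho = 2 * #|G|%:R - 4 &
  #|G|%:R - #|[set w | edge u w && edge v w]|%:R <= 200^-1 * #|G|%:R :> R].
  split; [exact: xu|exact: xv|exact: rho100|exact: rhoE|exact: common].
have nuv := hubs_nonadjacent planarG freeG x0 x1 rx vu hubsP.
have all_common := common_all planarG freeG x0 x1 rx vu hubsP.
have deg2 := rest_two_regular planarG freeG x0 x1 rx vu hubsP.
have uv : u != v by rewrite eq_sym.
have degA : {in [set w | edge u w && edge v w], forall w,
    deg_in edge [set w | edge u w && edge v w] w = 2%N}.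
  move=> w; rewrite inE => /andP[uw vw]; apply: deg2.
    by apply: contraTneq uw => ->; rewrite edge_irr.
  by apply: contraTneq vw => ->; rewrite edge_irr.
rewrite -cG; apply: (two_hubs_isomorphic planarG uv nuv all_common degA).
by rewrite -card_gt0 -(ltr_nat R); exact: pos_of_almost_all n3 common.
Qed.

End Main.

Theorem theorem1p7 (R : realType) :
  exists N : nat, forall n : nat, (N <= n)%N ->
    forall G : sgraph,
      SPEX_P R n K5_minus_e G <->
      isomorphic G (join (edgeless 2) (cycle_graph (n - 2)%N)).
Proof.
have [N hN] := wheel_of_large_radius R.
exists (N + 6)%N => n nN G; have n6 : (6 <= n)%N by lia.
have {}hN := hN n (leq_trans (leq_addr _ _) nN).
pose H := join (edgeless 2) (cycle_graph (n - 2)).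
have wheelP K : isomorphic K H -> planar_free R n K5_minus_e K.
  move=> KH; split.
  - case: (KH) => f bf _; rewrite (bij_eq_card bf) card_sum !card_ord; lia.
  - by apply: planar_isomorphic KH _; apply: join_cycle_planar; lia.
  - by apply: free_isomorphic KH _; apply: join_free; lia.
have HH : isomorphic H H by exists id => //; exact: (Bijective (fun _ => erefl) (fun _ => erefl)).
split=> [[Gfree Gmax]|GH].
  by apply: hN => //; rewrite -(spectral_radius_wheel R n6 HH); apply/Gmax/wheelP.
split=> [|K Kfree]; first exact: wheelP.
(* A competitor of larger radius would itself be isomorphic to [H], and so have the same radius. *)
rewrite (spectral_radius_wheel R n6 GH) leNgt; apply/negP => lt.
have KH := hN K Kfree (ltW lt).
by move: lt; rewrite (spectral_radius_wheel R n6 KH) ltxx.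
Qed.
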